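(* Let $p_1,p_2,p_3\ge0$ with $|\mathbf p|=p_1+p_2+p_3\le1$, and let $\mathcal N_{\mathbf p}$ be the qubit Pauli channel \[ \mathcal N_{\mathbf p}(\rho)=(1-|\mathbf p|)\rho+p_1X\rho X+p_2Y\rho Y+p_3Z\rho Z. \] Then the private classical capacity of $\mathcal N_{\mathbf p}$ satisfies $C_p(\mathcal N_{\mathbf p})\le 1-H(|\mathbf p|)$.
   Context: $X,Y,Z$ are the Pauli matrices and $H(q)=-q\log_2q-(1-q)\log_2(1-q)$ is the binary entropy. Private classical capacity: for a channel $\mathcal N$ from $A$ to $B$ with isometric extension $U_{\mathcal N}:A\to B\otimes E$ ($\mathcal N(\rho)=\mathrm{Tr}_EU_{\mathcal N}\rho U_{\mathcal N}^\dagger$), an $(n,K)$ key code is $K$ states $\rho_x$ on $A^{\otimes n}$ and a decoding measurement $\mathcal D_n$ on $B^{\otimes n}$ with outcomes $\{1,\dots,K\}$; with $\rho_{XB^nE^n}=\frac1K\sum_x|x\rangle\langle x|\otimes U_{\mathcal N}^{\otimes n}\rho_x(U_{\mathcal N}^{\otimes n})^\dagger$, it is $\epsilon$-good if $\|(I\otimes\mathcal D_n\otimes I)(\rho_{XB^nE^n})-\frac1K\sum_x|x\rangle\langle x|\otimes|x\rangle\langle x|\otimes\rho_{E^n}\|_1<\epsilon$, $\rho_{E^n}$ the reduced state on $E^{\otimes n}$. A rate $R$ is achievable if for every $\epsilon>0$ and sufficiently large $n$ there is an $\epsilon$-good code $C_n$ for $\mathcal N^{\otimes n}$ with $\lim_n\frac{\log|C_n|}{n}\ge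 R$; $C_p(\mathcal N)$ is the supremum of achievable rates. *)

(* Defs.v *)
From HB Require Import structures.
From mathcomp Require Import all_boot all_order all_algebra.
From mathcomp Require Import all_classical all_reals all_analysis.
From mathcomp Require Import complex.
From Stdlib Require ClassicalEpsilon.
Set Implicit Arguments. Unset Strict Implicit. Unset Printing Implicit Defensive.
Import Order.TTheory GRing.Theory Num.Theory.
Local Open Scope ring_scope.

Section QDefs.
Variable R : realType.
Notation C := R[i].

(** Finite-dimensional operators from C^J to C^I, indexed by finite types. *)
Definition op (I J : finType) := I -> J -> C.

Definition opmul (I J K : finType) (A : op I J) (B : op J K) : op I K :=
  fun i k => \sum_(j : J) A i j * B j k.
Definition adj (I J : finType) (A : op I J) : op J I := fun j i => (A i j)^*.
Definition idop (I : finType) : op I I := fun i j => (i == j)%:R.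
Definition trace (I : finType) (A : op I I) : C := \sum_(i : I) A i i.
Definition tens (I1 J1 I2 J2 : finType) (A : op I1 J1) (B : op I2 J2)
  : op (I1 * I2)%type (J1 * J2)%type :=
  fun i j => A i.1 j.1 * B i.2 j.2.
Definition ptrace2 (I J : finType) (A : op (I * J)%type (I * J)%type) : op I I :=
  fun i i' => \sum_(j : J) A (i, j) (i', j).

Definition psd (I : finType) (A : op I I) : Prop :=
  forall v : I -> C, 0 <= \sum_(i : I) \sum_(j : I) (v i)^* * A i j * v j.
Definition density (I : finType) (rho : op I I) : Prop :=
  psd rho /\ trace rho = 1.
Definition isometry (I J : finType) (V : op J I) : Prop :=
  opmul (adj V) V = @idop I.
Definition povm (Y I : finType) (M : Y -> op I I) : Prop :=
  (forall y, psd (M y)) /\ (forall i i', \sum_(y : Y) M y i i' = @idop I i i').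

(** |A| = sqrt(A^dagger A): the (unique) psd square root of A^dagger A. *)
Definition absop (I J : finType) (A : op I J) : op J J :=
  ClassicalEpsilon.epsilon (inhabits (fun _ _ => 0))
    (fun Q : op J J => psd Q /\ opmul Q Q = opmul (adj A) A).
Definition trnorm (I J : finType) (A : op I J) : R := complex.Re (trace (absop A)).

Definition pauliX : op 'I_2 'I_2 := fun i j => if i == j then 0 else 1.
Definition pauliY : op 'I_2 'I_2 :=
  fun i j => if i == j then 0 else if val i == 0%N then - 'i%C else 'i%C.
Definition pauliZ : op 'I_2 'I_2 :=
  fun i j => if i == j then (if val i == 0%N then 1 else -1) else 0.

Definition pauli_channel (p1 p2 p3 : R) (rho : op 'I_2 'I_2) : op 'I_2 'I_2 :=
  fun i j =>
    ((1 - (p1 + p2 + p3))%:C)%C * rho i j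
    + (p1%:C)%C * opmul (opmul pauliX rho) pauliX i j
    + (p2%:C)%C * opmul (opmul pauliY rho) pauliY i j
    + (p3%:C)%C * opmul (opmul pauliZ rho) pauliZ i j.

Definition isometric_extension (A B E : finType)
  (N : op A A -> op B B) (V : op (B * E)%type A) : Prop :=
  isometry V /\
  forall rho : op A A, density rho ->
    ptrace2 (opmul (opmul V rho) (adj V)) = N rho.

Definition nfold (n : nat) (T : finType) : finType := {ffun 'I_n -> T}.

(** the n-fold tensor power V^{(x)n}, with output regrouped as B^n (x) E^n *)
Definition isom_pow (A B E : finType) (n : nat) (V : op (B * E)%type A)
  : op (nfold n B * nfold n E)%type (nfold n A) :=
  fun be a => \prod_(k < n) V (be.1 k, be.2 k) (a k).

Definition proj (X : finType) (x : X) : op X X :=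
  fun i j => ((i == x) && (j == x))%:R.

Section Code.
Variables (A B E : finType) (V : op (B * E)%type A) (n K : nat).
Variables (rho : 'I_K -> op (nfold n A) (nfold n A))
          (M : 'I_K -> op (nfold n B) (nfold n B)).
Notation Bn := (nfold n B). Notation En := (nfold n E).
Let Vn := @isom_pow A B E n V.

Definition rhoXBE : op ('I_K * (Bn * En))%type ('I_K * (Bn * En))%type :=
  fun i j => K%:R^-1 * \sum_(x < K)
      tens (proj x) (opmul (opmul Vn (rho x)) (adj Vn)) i j.

Definition rhoE : op En En :=
  fun e e' => \sum_(x < K) \sum_(b : Bn) rhoXBE (x, (b, e)) (x, (b, e')).

(** (I (x) D_n (x) I) applied to rho_XBE, where
    D_n(sigma) = sum_y Tr(M_y sigma) |y><y| is the decoding measurement *)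
Definition measured_state
  : op ('I_K * ('I_K * En))%type ('I_K * ('I_K * En))%type :=
  fun i j =>
    let: (x, (y, e)) := i in let: (x', (y', e')) := j in
    (y == y')%:R * \sum_(b : Bn) \sum_(b' : Bn)
        M y b b' * rhoXBE (x, (b', e)) (x', (b, e')).

Definition ideal_state
  : op ('I_K * ('I_K * En))%type ('I_K * ('I_K * En))%type :=
  fun i j => K%:R^-1 * \sum_(x < K) tens (proj x) (tens (proj x) rhoE) i j.
End Code.

Definition good_key_code (A B E : finType) (V : op (B * E)%type A)
  (n K : nat) (eps : R) : Prop :=
  exists (rho : 'I_K -> op (nfold n A) (nfold n A))
         (M : 'I_K -> op (nfold n B) (nfold n B)),
    (forall x, density (rho x)) /\ povm M /\
    trnorm (fun i j => measured_state V rho M i j - ideal_state V rho i j) < eps.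

Definition log2 (x : R) : R := ln x / ln 2.

Definition achievable_rate (A B E : finType) (V : op (B * E)%type A) (r : R) : Prop :=
  forall eps : R, 0 < eps ->
    exists (N0 : nat) (Kn : nat -> nat),
      (forall n, (N0 <= n)%N -> good_key_code V n (Kn n) eps) /\
      (r%:E <= limn_einf (fun n => (log2 (Kn n)%:R / n%:R)%:E))%E.

Definition private_capacity (A B E : finType) (V : op (B * E)%type A) : \bar R :=
  ereal_sup [set r%:E | r in [set r : R | achievable_rate V r]].

Definition binH (q : R) : R :=
  (if q == 0 then 0 else - q * log2 q) + (if q == 1 then 0 else - (1 - q) * log2 (1 - q)).
End QDefs.

(* Main.v *)
(** Conditionally on a Pauli axis [i], the channel applies sigma_i with probability q =
p1 + p2 + p3, so an n-fold use of it applies a Pauli string P(i,s) where s consists of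
i.i.d. Bernoulli(q) bits.

A key code with factorizations rho_x = G_x G_x^* and M_x = L_x^* L_x defines a privacy
test, a linear functional of the Kraus operator [P] acting on the input:
  [P |-> 1/K sum_x W_x (L_x P G_x)],
where the contractions W_x come from the polar decompositions of L_x V G_x seen as
operators on the environment. If the code is good, the squared norm of the test,
averaged over the Kraus operators of the channel, is close to 1: W_x turns L_x V G_x
into the square root of Eve's state given x, and these square roots are close to each
other by the Powers-Stormer inequality. If the bits of s were uniform, the channel would
dephase completely in the eigenbases of the sigma_i; its Kraus operators would be rank
one, and the Cauchy-Schwarz inequality bounds the same average by 1/K.

The squared norm of the test is therefore a classical test distinguishing Bernoulli(q)^n
from the uniform distribution on n bits, whose relative entropy is n (1 - H(q)) bits,
and Gibbs' variational principle gives (1 - delta)^2 log2 K <= n (1 - H(q)) + 1. *)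
Require Import Defs.
From HB Require Import structures.
From mathcomp Require Import all_boot all_order all_algebra.
From mathcomp Require Import all_classical all_reals all_analysis.
From mathcomp Require Import complex.
From mathcomp Require Import ring lra.
Import Order.TTheory GRing.Theory Num.Theory.
Import numFieldNormedType.Exports.
Local Open Scope ring_scope.
Set Implicit Arguments. Unset Strict Implicit. Unset Printing Implicit Defensive.

(** * Operators on finite-dimensional spaces *)

Section Operators.
Variable R : realType.
Notation C := R[i].
Implicit Types I J K : finType.

Lemma opP I J (A B : op R I J) : (forall i j, A i j = B i j) -> A = B.
Proof. by move=> h; apply: funext => i; apply: funext => j. Qed.

Lemma sum_deltal I (F : I -> C) (i : I) : \sum_j (i == j)%:R * F j = F i.
Proof.
rewrite (bigD1 i) //= eqxx mul1r big1 ?addr0 // => j ji.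
by rewrite eq_sym (negbTE ji) mul0r.
Qed.

Lemma sum_deltar I (F : I -> C) (i : I) : \sum_j F j * (j == i)%:R = F i.
Proof.
rewrite -[RHS](sum_deltal F i); apply: eq_bigr => j _.
by rewrite mulrC eq_sym.
Qed.

Lemma opmulA I J K (L : finType) (A : op R I J) (B : op R J K) (D : op R K L) :
  opmul A (opmul B D) = opmul (opmul A B) D.
Proof.
apply: opP => i l; rewrite /opmul.
under eq_bigr => j _ do rewrite big_distrr /=.
rewrite exchange_big /=; apply: eq_bigr => k _.
by rewrite big_distrl /=; apply: eq_bigr => j _; rewrite mulrA.
Qed.

Lemma opmul1l I J (A : op R I J) : opmul (@idop R I) A = A.
Proof. by apply: opP => i j; rewrite /opmul sum_deltal. Qed.

Lemma opmul1r I J (A : op R I J) : opmul A (@idop R J) = A.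
Proof. by apply: opP => i j; rewrite /opmul sum_deltar. Qed.

Lemma adjM I J K (A : op R I J) (B : op R J K) :
  adj (opmul A B) = opmul (adj B) (adj A).
Proof.
apply: opP => k i; rewrite /adj /opmul rmorph_sum /=.
by apply: eq_bigr => j _; rewrite rmorphM mulrC.
Qed.

Lemma adjK I J (A : op R I J) : adj (adj A) = A.
Proof. by apply: opP => i j; rewrite /adj conjCK. Qed.

Lemma traceC I J (A : op R I J) (B : op R J I) :
  trace (opmul A B) = trace (opmul B A).
Proof.
rewrite /trace /opmul exchange_big /=; apply: eq_bigr => j _.
by apply: eq_bigr => i _; rewrite mulrC.
Qed.

Definition dgop I (d : I -> C) : op R I I := fun i j => d i * (i == j)%:R.

Lemma dgopM I (d e : I -> C) :
  opmul (dgop d) (dgop e) = dgop (fun i => d i * e i).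
Proof.
apply: opP => i j; rewrite /opmul /dgop.
under eq_bigr => k _ do rewrite -mulrA mulrCA.
rewrite sum_deltal; ring.
Qed.

Lemma adj_dgop I (d : I -> C) : adj (dgop d) = dgop (fun i => (d i)^*).
Proof.
apply: opP => i j; rewrite /adj /dgop rmorphM /= rmorph_nat eq_sym.
by case: eqP => [->|]; rewrite ?mulr0.
Qed.

Lemma opmul_dgE I J (A : op R I J) (d : J -> C) i j :
  opmul A (dgop d) i j = A i j * d j.
Proof.
rewrite /opmul /dgop; under eq_bigr => k _ do rewrite mulrA.
by rewrite sum_deltar.
Qed.

Lemma opmul_dglE I J (A : op R I J) (d : I -> C) i j :
  opmul (dgop d) A i j = d i * A i j.
Proof.
rewrite /opmul /dgop; under eq_bigr => k _ do rewrite -mulrA mulrCA.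
by rewrite sum_deltal.
Qed.

Definition sqn I (v : I -> C) : C := \sum_i `|v i| ^+ 2.

Lemma sqn_ge0 I (v : I -> C) : 0 <= sqn v.
Proof. by apply: sumr_ge0 => i _; rewrite exprn_ge0. Qed.

Lemma sqnE I (v : I -> C) : sqn v = \sum_i v i * (v i)^*.
Proof. by apply: eq_bigr => i _; rewrite normCK. Qed.

(** Lagrange's identity: after symmetrization, twice the difference of the two sides is the double
    sum of the squares of [a j * b i - a i * b j]. *)
Lemma CauchySchwarz_ge0 I (a b : I -> C) :
  (forall i, 0 <= a i) -> (forall i, 0 <= b i) ->
  (\sum_i a i * b i) ^+ 2 <= (\sum_i a i ^+ 2) * (\sum_i b i ^+ 2).
Proof.
move=> a0 b0; rewrite expr2 !big_distrlr /= -(@ler_pM2l _ 2%:R) ?ltr0n //.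
rewrite mulr2n mulrDl mul1r mulrDl mul1r [X in _ <= X + _]exchange_big /=.
rewrite -!big_split /=; apply: ler_sum => i _; rewrite -!big_split /=.
apply: ler_sum => j _; rewrite -subr_ge0.
set y := (X in 0 <= X).
have -> : y = (a j * b i - a i * b j) ^+ 2 by rewrite /y; ring.
by apply: real_exprn_even_ge0 => //; rewrite realB ?realM ?ger0_real.
Qed.

Lemma CauchySchwarz_sqn I (v w : I -> C) :
  `|\sum_i v i * w i| ^+ 2 <= sqn v * sqn w.
Proof.
apply: le_trans (CauchySchwarz_ge0 (fun i => normr_ge0 (v i))
  (fun i => normr_ge0 (w i))).
have s0 : 0 <= \sum_i `|v i| * `|w i| by apply: sumr_ge0 => i _; rewrite mulr_ge0.
rewrite ler_sqr ?nnegrE //; apply: le_trans (ler_norm_sum _ _ _) _.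
by apply: ler_sum => i _; rewrite normrM.
Qed.

Lemma le_norm_inner I (v w : I -> C) :
  `|\sum_i v i * (w i)^*| <= sqrtC (sqn v) * sqrtC (sqn w).
Proof.
rewrite -ler_sqr ?nnegrE ?mulr_ge0 ?sqrtC_ge0 ?sqn_ge0 //.
rewrite exprMn !sqrtCK; apply: le_trans (CauchySchwarz_sqn _ _) _.
by rewrite [X in _ * X]/sqn; under eq_bigr => i _ do rewrite norm_conjC.
Qed.

(* Minkowski's inequality followed by Cauchy-Schwarz *)
Lemma sqn_sum_le (X : finType) I (v : X -> I -> C) (a b : X -> C) :
  (forall x, 0 <= a x) -> (forall x, 0 <= b x) ->
  (forall x, sqn (v x) <= a x * b x) ->
  sqn (fun i => \sum_x v x i) <= (\sum_x a x) * (\sum_x b x).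
Proof.
move=> a0 b0 vab.
have E : sqn (fun i => \sum_x v x i) =
    \sum_x \sum_y \sum_i v x i * (v y i)^*.
  rewrite sqnE; under eq_bigr => i _ do rewrite rmorph_sum big_distrlr /=.
  by rewrite exchange_big /=; apply: eq_bigr => x _; rewrite exchange_big.
have s0 := sqn_ge0 (fun i => \sum_x v x i).
rewrite E in s0 *.
pose r (c : X -> C) x := sqrtC (c x).
apply: (@le_trans _ _ ((\sum_x r a x * r b x) ^+ 2)).
  rewrite expr2 big_distrlr /=.
  have rr x : sqrtC (sqn (v x)) <= r a x * r b x.
    rewrite -ler_sqr ?nnegrE ?mulr_ge0 ?sqrtC_ge0 ?sqn_ge0 //.
    by rewrite exprMn !sqrtCK.
  have h x y : `|\sum_i v x i * (v y i)^*| <= r a x * r b x * (r a y * r b y).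
    apply: le_trans (le_norm_inner _ _) _.
    by rewrite ler_pM ?sqrtC_ge0 ?sqn_ge0.
  apply: (le_trans (real_ler_norm (ger0_real s0))).
  apply: le_trans (ler_norm_sum _ _ _) _; apply: ler_sum => x _.
  by apply: le_trans (ler_norm_sum _ _ _) _; apply: ler_sum.
apply: le_trans (CauchySchwarz_ge0 _ _) _ => [x|x|]; rewrite ?sqrtC_ge0 //.
by under eq_bigr => x _ do rewrite sqrtCK; under [X in _ * X]eq_bigr => x _ do rewrite sqrtCK.
Qed.

(** Polarization: the quadratic form of [A] at [e_k + c e_l]. The values 0, 1 and ['i] of [c] are
    used to recover the entries of [A]. *)
Lemma quadratic_pair I (A : op R I I) k l (c : C) :
  \sum_i \sum_j ((k == i)%:R + c * (l == i)%:R)^* * A i j *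
     ((k == j)%:R + c * (l == j)%:R) =
  A k k + A k l * c + c^* * A l k + c^* * A l l * c.
Proof.
transitivity (\sum_i ((k == i)%:R + c * (l == i)%:R)^* * (A i k + A i l * c)).
  apply: eq_bigr => x _; under eq_bigr => y _ do rewrite -mulrA.
  rewrite -mulr_sumr; congr (_ * _).
  under eq_bigr => y _ do rewrite mulrDr mulrC [X in _ + X]mulrCA.
  rewrite big_split /= sum_deltal; congr (_ + _).
  under eq_bigr => y _ do rewrite [_ * (l == y)%:R]mulrC mulrCA.
  by rewrite sum_deltal mulrC.
under eq_bigr => x _ do rewrite rmorphD rmorphM /= !rmorph_nat mulrDl -!mulrA [X in _ + X]mulrCA.
by rewrite big_split /= !sum_deltal; ring.
Qed.

(** A form that is nonnegative, hence real, on all vectors is Hermitian: [c = 1] controls the sum of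
    two opposite off-diagonal entries, [c = 'i] their difference. *)
Lemma psd_adj I (A : op R I I) : psd A -> adj A = A.
Proof.
move=> Ap; apply: opP => i j; rewrite /adj.
have q (v : I -> C) : (\sum_i \sum_j (v i)^* * A i j * v j)^* =
    \sum_i \sum_j (v i)^* * A i j * v j.
  by apply: conj_Creal; apply: ger0_real.
have h1 := q (fun x => (j == x)%:R + 1 * (i == x)%:R).
have h2 := q (fun x => (j == x)%:R + 'i * (i == x)%:R).
have h3 := q (fun x => (j == x)%:R + 0 * (i == x)%:R).
have h4 := q (fun x => (i == x)%:R + 0 * (i == x)%:R).
move: h1 h2 h3 h4; rewrite !quadratic_pair !rmorphD !rmorphM /= !conjCK !rmorph1 !rmorph0 conjCi !mul0r !mulr0 !addr0 !mul1r !mulr1.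
move=> h1 h2 h3 h4; rewrite h3 h4 in h1 h2.
have g1 : (A j i)^* + (A i j)^* = A j i + A i j.
  by move/addIr: h1 => h1; apply: (@addrI _ (A j j)); rewrite !addrA.
have g2 : (A i j)^* - (A j i)^* = A j i - A i j.
  have i2 : 'i * 'i = -1 :> C by rewrite -expr2 sqrCi.
  have h : - ('i * (A j i)^*) + 'i * (A i j)^* = 'i * A j i - 'i * A i j.
    apply: (@addrI _ (A j j + - 'i * A i i * 'i)); transitivity
      (A j j + 'i * (A i j)^* - 'i * (A j i)^* + - 'i * A i i * 'i); first by ring.
    transitivity (A j j + (A j i)^* * - 'i + 'i * (A i j)^* + 'i * A i i * - 'i); first by ring.
    by rewrite h2; ring.
  have : 'i * ((A i j)^* - (A j i)^*) = 'i * (A j i - A i j) :> C.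
    by rewrite mulrBr mulrBr -h addrC.
  by move/(mulfI (neq0Ci C)).
have : 2%:R * (A j i)^* = 2%:R * A i j.
  have -> : 2%:R * (A j i)^* = (A j i)^* + (A i j)^* - ((A i j)^* - (A j i)^*) by ring.
  by rewrite g1 g2; ring.
by move/(mulfI _); apply; rewrite pnatr_eq0.
Qed.

End Operators.

(** * Spectral decomposition and the trace norm *)

Section Spectral.
Variable R : realType.
Notation C := R[i].
Implicit Types I J K : finType.

(** The spectral theorem for matrices, transported along the enumeration of [I]. It writes [M] as
    P^-1 diag P, so [U] is the adjoint of [P]. *)
Lemma spectral_op I (A : op R I I) : adj A = A ->
  exists (U : op R I I) (d : I -> C),
  [/\ opmul (adj U) U = @idop R I, opmul U (adj U) = @idop R I,
      forall i, d i \is Num.real & A = opmul (opmul U (dgop d)) (adj U)].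
Proof.
move=> hA; pose M := (\matrix_(i < #|I|, j < #|I|) A (enum_val i) (enum_val j)) : 'M[C]_#|I|.
have hM : M \is hermsymmx.
  apply/is_hermitianmxP; rewrite expr0 scale1r; apply/matrixP => i j.
  by rewrite !mxE -{1}hA.
have := orthomx_spectralP (hermitian_normalmx hM).
have PU := spectral_unitarymx M.
rewrite (invmx_unitary PU).
have := hermitian_spectral_diag_real hM.
set P := spectralmx M in PU *; set sp := spectral_diag M => spr ME.
have /unitarymxP PP := PU.
have PP' : map_mx Num.conj P^T *m P = 1%:M by rewrite -[map_mx _ _](invmx_unitary PU) mulVmx ?unitarymx_unit.
exists (fun x k => (P (enum_rank k) (enum_rank x))^*), (fun k => sp 0 (enum_rank k)).
have reI (F : 'I_#|I| -> C) : \sum_i F i = \sum_(x : I) F (enum_rank x).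
  by rewrite (reindex (@enum_rank I)) //=; apply: onW_bij; apply: enum_rank_bij.
have idE (x y : I) : (1%:M : 'M[C]_#|I|) (enum_rank x) (enum_rank y) = @idop R I x y.
  by rewrite mxE /idop (inj_eq enum_rank_inj).
split.
- apply: opP => x y; rewrite -idE -PP !mxE reI.
  by apply: eq_bigr => z _; rewrite /adj conjCK !mxE.
- apply: opP => x y; rewrite -idE -PP' !mxE reI.
  by apply: eq_bigr => z _; rewrite /adj conjCK !mxE.
- by move=> i; move/mxOverP: spr; apply.
- apply: opP => x y.
  transitivity (M (enum_rank x) (enum_rank y)); first by rewrite mxE !enum_rankK.
  rewrite ME mxE reI; apply: eq_bigr => z _.
  by rewrite mul_mx_diag !mxE opmul_dgE /adj conjCK.
Qed.

Lemma spectral_psd I (A : op R I I) : psd A ->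
  exists (U : op R I I) (d : I -> C),
  [/\ opmul (adj U) U = @idop R I, opmul U (adj U) = @idop R I,
      forall i, 0 <= d i & A = opmul (opmul U (dgop d)) (adj U)].
Proof.
move=> Ap; have [U [d [U1 U2 _ E]]] := spectral_op (psd_adj Ap).
exists U, d; split=> // k.
(* The eigenvalue is the quadratic form of [A] at the k-th column of [U]. *)
have : opmul (opmul (adj U) A) U k k = d k.
  rewrite E !opmulA U1 opmul1l -opmulA U1 opmul1r /dgop eqxx mulr1 //.
move=> <-; have := Ap (fun i => U i k); congr (0 <= _).
rewrite /opmul exchange_big /=; apply: eq_bigr => j _.
by rewrite mulr_suml; apply: eq_bigr.
Qed.

Lemma psd_gram I J (G : op R I J) : psd (opmul G (adj G)).
Proof.
move=> v.
have -> : \sum_i \sum_j (v i)^* * opmul G (adj G) i j * v j =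
    sqn (fun k => \sum_i (v i)^* * G i k).
  rewrite sqnE.
  transitivity (\sum_i \sum_j \sum_k (v i)^* * G i k * ((v j)^* * G j k)^*).
    apply: eq_bigr => i _; apply: eq_bigr => j _.
    rewrite /opmul /adj mulr_sumr mulr_suml; apply: eq_bigr => k _.
    by rewrite rmorphM /= conjCK !mulrA -!mulrA; congr (_ * (_ * _)); rewrite mulrC.
  under [RHS]eq_bigr => k _ do rewrite rmorph_sum big_distrlr /=.
  by rewrite [RHS]exchange_big /=; apply: eq_bigr => i _; rewrite exchange_big.
exact: sqn_ge0.
Qed.

Lemma psd_spectral I (U : op R I I) (d : I -> C) : (forall i, 0 <= d i) ->
  psd (opmul (opmul U (dgop d)) (adj U)).
Proof.
move=> d0; have -> : opmul (opmul U (dgop d)) (adj U) =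
    opmul (opmul U (dgop (fun i => sqrtC (d i)))) (adj (opmul U (dgop (fun i => sqrtC (d i))))).
  have -> : dgop d = opmul (dgop (fun i => sqrtC (d i))) (dgop (fun i => sqrtC (d i))).
    by rewrite dgopM; congr dgop; apply: funext => i; rewrite -expr2 sqrtCK.
  rewrite adjM adj_dgop; have -> : (fun i => (sqrtC (d i))^*) = (fun i => sqrtC (d i)).
    by apply: funext => i; rewrite conj_Creal // ger0_real ?sqrtC_ge0.
  by rewrite !opmulA.
exact: psd_gram.
Qed.

Lemma psd_sqrt I (A : op R I I) : psd A -> exists2 Q : op R I I, psd Q & opmul Q Q = A.
Proof.
move=> /spectral_psd [U [d [U1 U2 d0 E]]].
exists (opmul (opmul U (dgop (fun i => sqrtC (d i)))) (adj U)).
  by apply: psd_spectral => i; rewrite sqrtC_ge0.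
rewrite E -!opmulA (opmulA (adj U)) U1 opmul1l (opmulA (dgop _)) dgopM.
by do 3 f_equal; apply: funext => i; rewrite -expr2 sqrtCK.
Qed.

Lemma psd_factor I (A : op R I I) : psd A -> exists G : op R I I, A = opmul G (adj G).
Proof. by move=> /psd_sqrt [Q /psd_adj Qa <-]; exists Q; rewrite Qa. Qed.

Definition opv I J (A : op R I J) (v : J -> C) : I -> C := fun i => \sum_j A i j * v j.

Definition contractive I J (A : op R I J) := forall v, sqn (opv A v) <= sqn v.

Lemma trace_unitary I (U A : op R I I) : opmul U (adj U) = @idop R I ->
  trace A = trace (opmul (opmul (adj U) A) U).
Proof. by move=> UU; rewrite traceC opmulA UU opmul1l. Qed.

Lemma sqn_opv I J (A : op R I J) (v : J -> C) :
  sqn (opv A v) = \sum_j \sum_k (v j)^* * opmul (adj A) A j k * v k.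
Proof.
rewrite sqnE /opv; under eq_bigr => i _ do rewrite rmorph_sum mulrC big_distrlr /=.
rewrite exchange_big /=; apply: eq_bigr => j _.
rewrite exchange_big /=; apply: eq_bigr => k _.
rewrite /opmul /adj mulr_sumr mulr_suml; apply: eq_bigr => i _.
by rewrite rmorphM /=; ring.
Qed.

Lemma sum_idop_quad I (v : I -> C) :
  \sum_j \sum_k (v j)^* * @idop R I j k * v k = sqn v.
Proof.
rewrite sqnE; apply: eq_bigr => j _; under eq_bigr => k _ do rewrite -mulrA.
by rewrite -mulr_sumr /idop sum_deltal mulrC.
Qed.

Lemma sqn_isometry I J (A : op R I J) (v : J -> C) :
  opmul (adj A) A = @idop R J -> sqn (opv A v) = sqn v.
Proof. by move=> AA; rewrite sqn_opv AA sum_idop_quad. Qed.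

(* In the eigenbasis u_k of Q, <u_k, X^* D u_k> is at most |D u_k|, the k-th eigenvalue
of Q. *)
Lemma norm_trace_le_sqrt I (D X Q : op R I I) : contractive X ->
  psd Q -> opmul Q Q = opmul (adj D) D -> `|trace (opmul (adj X) D)| <= trace Q.
Proof.
move=> Xc Qp QD; have [U [d [U1 U2 d0 E]]] := spectral_psd Qp.
rewrite (trace_unitary Q U2) (trace_unitary (opmul _ D) U2).
have -> : opmul (opmul (adj U) Q) U = dgop d.
  by rewrite E !opmulA U1 opmul1l -opmulA U1 opmul1r.
apply: le_trans (ler_norm_sum _ _ _) _; apply: ler_sum => k _.
rewrite /dgop eqxx mulr1.
pose u : I -> C := fun i => U i k.
have su : sqn u = 1.
  have : opmul (adj U) U k k = 1 by rewrite U1 /idop eqxx.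
  by move=> <-; rewrite sqnE; apply: eq_bigr => i _; rewrite /u mulrC.
have -> : opmul (opmul (adj U) (opmul (adj X) D)) U k k =
    \sum_i opv D u i * (opv X u i)^*.
  rewrite !opmulA -adjM -opmulA; apply: eq_bigr => i _.
  by rewrite mulrC.
have sD : sqn (opv D u) = d k ^+ 2.
  have -> : sqn (opv D u) = opmul (opmul (adj U) (opmul (adj D) D)) U k k.
    rewrite !opmulA -adjM -opmulA sqnE; apply: eq_bigr => i _.
    by rewrite mulrC.
  rewrite -QD E !opmulA U1 opmul1l -!opmulA U1 opmul1r (opmulA (adj U)) U1 opmul1l.
  by rewrite dgopM /dgop eqxx mulr1.
apply: le_trans (le_norm_inner _ _) _; rewrite sD -[X in _ <= X]mulr1.
rewrite exprnP sqrCK // ler_wpM2l // -sqrtC1 ler_sqrtC ?nnegrE ?sqn_ge0 ?ler01 //.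
by rewrite -su.
Qed.

(** Duality bound for the trace norm. [absop D] is picked by epsilon, so its properties come from
    the existence of a positive square root; its trace is real, so taking the real part in [trnorm]
    loses nothing. *)
Lemma norm_trace_le_trnorm I (D X : op R I I) : contractive X ->
  `|trace (opmul (adj X) D)| <= (trnorm D)%:C%C.
Proof.
move=> Xc.
have [Qp QE] : psd (absop D) /\ opmul (absop D) (absop D) = opmul (adj D) D.
  have ex : exists Q : op R I I, psd Q /\ opmul Q Q = opmul (adj D) D.
    have [|Q Qp QE] := @psd_sqrt _ (opmul (adj D) D); last by exists Q.
    by rewrite -{2}(adjK D); apply: psd_gram.
  exact: (ClassicalEpsilon.epsilon_spec (inhabits (fun _ _ => 0)) _ ex).
have h := norm_trace_le_sqrt Xc Qp QE.
rewrite /trnorm; have : trace (absop D) \is Num.real.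
  by apply: ger0_real; apply: (le_trans (normr_ge0 _) h).
by move=> /RRe_real ->.
Qed.

End Spectral.

(** * Powers-Stormer inequality and polar decomposition *)

Section PowersStormer.
Variable R : realType.
Notation C := R[i].
Implicit Types I J K : finType.

Definition opsub I J (A B : op R I J) : op R I J := fun i j => A i j - B i j.

(** The squared Hilbert-Schmidt norm. *)
Definition hs I J (A : op R I J) : C := sqn (fun ij : I * J => A ij.1 ij.2).

Lemma hs_trace I J (A : op R I J) : hs A = trace (opmul (adj A) A).
Proof.
rewrite /hs sqnE -(pair_bigA _ (fun i j => A i j * (A i j)^*)) /= exchange_big /=.
by apply: eq_bigr => j _; apply: eq_bigr => i _; rewrite mulrC.
Qed.

Lemma opmulBr I J K (A : op R I J) (B D : op R J K) :
  opmul A (opsub B D) = opsub (opmul A B) (opmul A D).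
Proof.
apply: opP => i k; rewrite /opmul /opsub -sumrB.
by apply: eq_bigr => j _; rewrite mulrBr.
Qed.

Lemma opmulBl I J K (A B : op R I J) (D : op R J K) :
  opmul (opsub A B) D = opsub (opmul A D) (opmul B D).
Proof.
apply: opP => i k; rewrite /opmul /opsub -sumrB.
by apply: eq_bigr => j _; rewrite mulrBl.
Qed.

Lemma psd_diag_ge0 I (A : op R I I) k : psd A -> 0 <= A k k.
Proof.
move=> /(_ (fun i => (i == k)%:R)).
have -> : \sum_i \sum_j ((i == k)%:R)^* * A i j * (j == k)%:R = A k k :> C.
  under eq_bigr => i _ do rewrite sum_deltar rmorph_nat eq_sym.
  by rewrite sum_deltal.
by [].
Qed.

Lemma psd_conj I J (U : op R I J) (A : op R I I) : psd A -> psd (opmul (opmul (adj U) A) U).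
Proof.
move=> /psd_factor [G ->].
have -> : opmul (opmul (adj U) (opmul G (adj G))) U = opmul (opmul (adj U) G) (adj (opmul (adj U) G)).
  by rewrite adjM adjK !opmulA.
exact: psd_gram.
Qed.

(* X is the sign of A - B. In an eigenbasis of A - B the k-th diagonal entry of A^2 -
B^2 is (A_kk - B_kk) (A_kk + B_kk), and |A_kk - B_kk| <= A_kk + B_kk. *)
Lemma powers_stormer I (A B : op R I I) : psd A -> psd B ->
  exists X : op R I I, [/\ adj X = X, opmul X X = @idop R I &
    hs (opsub A B) <= trace (opmul X (opsub (opmul A A) (opmul B B)))].
Proof.
move=> Ap Bp.
have hD : adj (opsub A B) = opsub A B.
  by rewrite -{2}(psd_adj Ap) -{2}(psd_adj Bp); apply: opP => i j; rewrite /adj /opsub rmorphB.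
have [U [d [U1 U2 dr E]]] := spectral_op hD.
(* The sign of a zero eigenvalue is 1 rather than 0, so that [X] squares to the identity. *)
pose s k : C := if 0 <= d k then 1 else -1.
have ss k : s k * s k = 1 by rewrite /s; case: ifP => _; rewrite ?mulrNN mulr1.
pose X := opmul (opmul U (dgop s)) (adj U).
have sc k : (s k)^* = s k by rewrite /s; case: ifP => _; rewrite ?rmorphN rmorph1.
exists X; split.
- rewrite /X !adjM adjK adj_dgop opmulA; do 3 f_equal.
  by apply: funext => k; rewrite sc.
- rewrite /X -!opmulA (opmulA (adj U)) U1 opmul1l (opmulA (dgop s)) dgopM.
  have -> : (fun i => s i * s i) = (fun=> 1) by apply: funext => k; rewrite ss.
  have -> : dgop (fun=> 1) = @idop R I by apply: opP => i j; rewrite /dgop mul1r.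
  by rewrite opmul1l.
pose A' := opmul (opmul (adj U) A) U.
pose B' := opmul (opmul (adj U) B) U.
have AB : opsub A' B' = dgop d.
  rewrite /A' /B' -opmulBl -opmulBr E.
  by rewrite !opmulA U1 opmul1l -opmulA U1 opmul1r.
rewrite hs_trace hD {1 2}E.
have -> : trace (opmul (opmul (opmul U (dgop d)) (adj U)) (opmul (opmul U (dgop d)) (adj U))) = \sum_k d k * d k.
  rewrite -!opmulA (opmulA (adj U)) U1 opmul1l (opmulA (dgop d)) dgopM traceC -opmulA U1 opmul1r.
  by apply: eq_bigr => k _; rewrite /dgop eqxx mulr1.
rewrite (trace_unitary _ U2).
have -> : opmul (opmul (adj U) (opmul X (opsub (opmul A A) (opmul B B)))) U
   = opmul (dgop s) (opsub (opmul A' A') (opmul B' B')).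
  have sq (T : op R I I) : opmul (opmul (opmul (adj U) T) U) (opmul (opmul (adj U) T) U) =
      opmul (opmul (adj U) (opmul T T)) U.
    by rewrite -!opmulA (opmulA U) U2 opmul1l.
  rewrite /A' /B' !sq -opmulBl -opmulBr /X.
  by rewrite !opmulA U1 opmul1l.
apply: ler_sum => k _; rewrite opmul_dglE.
have dk : d k = A' k k - B' k k.
  by have := congr1 (fun F : op R I I => F k k) AB; rewrite /opsub /dgop eqxx mulr1.
(* Off the diagonal [A'] and [B'] agree, so only the term [j = k] of the difference of squares
   survives. *)
have -> : opsub (opmul A' A') (opmul B' B') k k = d k * (A' k k + B' k k).
  rewrite /opsub /opmul -sumrB (bigD1 k) //= [X in _ + X]big1 ?addr0; last first.
    move=> j jk.
    have kj : A' k j = B' k j.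
      have := congr1 (fun F : op R I I => F k j) AB; rewrite /opsub /dgop.
      by rewrite eq_sym (negbTE jk) mulr0 => /eqP; rewrite subr_eq0 => /eqP.
    have kj' : A' j k = B' j k.
      have := congr1 (fun F : op R I I => F j k) AB; rewrite /opsub /dgop.
      by rewrite (negbTE jk) mulr0 => /eqP; rewrite subr_eq0 => /eqP.
    by rewrite kj kj' subrr.
  by rewrite dk; ring.
have a0 : 0 <= A' k k by apply: psd_diag_ge0; apply: psd_conj.
have b0 : 0 <= B' k k by apply: psd_diag_ge0; apply: psd_conj.
rewrite mulrA /s; case: ifP => d0.
  rewrite mul1r ler_wpM2l // dk lerD2l; apply: (le_trans _ b0).
  by rewrite oppr_le0.
have dl : d k <= 0 by case/orP: (dr k) => //; rewrite d0.
rewrite mulN1r -mulrNN ler_wpM2l ?oppr_ge0 // dk opprB addrC lerD2r.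
by apply: (le_trans _ a0); rewrite oppr_le0.
Qed.

Lemma isometry_contractive I J (A : op R I J) : opmul (adj A) A = @idop R J -> contractive A.
Proof. by move=> h v; rewrite sqn_isometry. Qed.

(** Vectors are rows [w] here, hence the transpose. With x = w W, the squared norm of w - x W^*
    expands to |w|^2 - |x|^2, because W W^* W = W turns every other term into |x|^2 up to sign. *)
Lemma partial_isometry_contractive I J (W : op R I J) :
  opmul (opmul W (adj W)) W = W -> contractive (fun j i => W i j).
Proof.
move=> WW v.
pose w : op R unit I := fun _ i => v i.
have nE K (a : op R unit K) : sqn (a tt) = opmul a (adj a) tt tt by rewrite sqnE.
have -> : opv (fun j i => W i j) v = opmul w W tt.
  by apply: funext => j; apply: eq_bigr => i _; rewrite mulrC.
have -> : sqn v = sqn (w tt) by [].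
set x := opmul w W.
have h := sqn_ge0 (opsub w (opmul x (adj W)) tt).
rewrite nE in h.
have adjB (a b : op R unit I) : adj (opsub a b) = opsub (adj a) (adj b).
  by apply: opP => i j; rewrite /adj /opsub rmorphB.
rewrite adjB opmulBl !opmulBr adjM adjK in h.
have e1 : opmul w (opmul W (adj x)) = opmul x (adj x) by rewrite opmulA.
have e2 : opmul (opmul x (adj W)) (adj w) = opmul x (adj x) by rewrite /x adjM !opmulA.
have e3 : opmul (opmul x (adj W)) (opmul W (adj x)) = opmul x (adj x).
  by rewrite opmulA; congr opmul; rewrite /x -!opmulA (opmulA W) WW.
rewrite e1 e2 e3 /opsub subrr subr0 subr_ge0 in h.
by rewrite !nE.
Qed.

(** The witness is [adj T] times the inverse square root of [opmul T (adj T)] on its support, a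
    partial isometry. The privacy test applies its transpose to vectors. *)
Lemma polar I J (T : op R I J) : exists (W : op R J I) (Q : op R I I),
  [/\ contractive (fun i j => W j i), psd Q, opmul Q Q = opmul T (adj T) & opmul T W = Q].
Proof.
have [U [d [U1 U2 d0 E]]] := spectral_psd (psd_gram T).
pose r k := sqrtC (d k).
(* As [0^-1 = 0], [g] inverts [r] on the support and vanishes elsewhere. *)
pose g k := (r k)^-1.
have r0 k : 0 <= r k by rewrite sqrtC_ge0.
have rc k : (g k)^* = g k by rewrite conj_Creal // ger0_real // invr_ge0.
have rr k : r k * r k = d k by rewrite -expr2 sqrtCK.
pose W := opmul (adj T) (opmul (opmul U (dgop g)) (adj U)).
have TW : opmul T W = opmul (opmul U (dgop r)) (adj U).
  rewrite /W opmulA E -!opmulA (opmulA (adj U)) U1 opmul1l (opmulA (dgop d)) dgopM.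
  do 3 f_equal; apply: funext => k; rewrite -rr /g.
  by have [->|nz] := eqVneq (r k) 0; rewrite ?mul0r // mulfK.
exists W, (opmul (opmul U (dgop r)) (adj U)); split=> //.
- apply: partial_isometry_contractive.
  have aW : adj W = opmul (opmul (opmul U (dgop g)) (adj U)) T.
    rewrite /W !adjM !adjK adj_dgop !opmulA; do 4 f_equal.
    by apply: funext => k; rewrite rc.
  rewrite aW -!opmulA TW {1}/W.
  rewrite -!opmulA; congr opmul; rewrite !(opmulA (adj U) U) U1 !opmul1l.
  congr opmul; rewrite !opmulA !dgopM; congr opmul; congr dgop.
  apply: funext => k; rewrite /g.
  by have [->|nz] := eqVneq (r k) 0; rewrite ?invr0 ?mul0r // -mulrA mulVf // mulr1.
- exact: psd_spectral.
- rewrite E -!opmulA (opmulA (adj U)) U1 opmul1l (opmulA (dgop _)) dgopM.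
  by do 3 f_equal; apply: funext => k; rewrite rr.
Qed.

End PowersStormer.

(** * The privacy test *)

Section SqnExtra.
Variable R : realType.
Notation C := R[i].
Implicit Types I J : finType.

Lemma sqnZ I (c : C) (v : I -> C) : sqn (fun i => c * v i) = `|c| ^+ 2 * sqn v.
Proof. by rewrite /sqn mulr_sumr; apply: eq_bigr => i _; rewrite normrM exprMn. Qed.

(** The case of two vectors in [sqn_sum_le], with both weights equal to the norm. *)
Lemma sqrt_sqn_triangle I (u v : I -> C) :
  sqrtC (sqn (fun i => u i + v i)) <= sqrtC (sqn u) + sqrtC (sqn v).
Proof.
pose a (b : bool) := sqrtC (sqn (if b then u else v)).
have a0 b : 0 <= a b by rewrite sqrtC_ge0 sqn_ge0.
have := @sqn_sum_le R bool I (fun b => if b then u else v) a a a0 a0.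
rewrite !big_bool /=.
have -> : (fun i => \sum_(b : bool) (if b then u else v) i) = (fun i => u i + v i).
  by apply: funext => i; rewrite big_bool.
move=> h; rewrite -ler_sqr ?nnegrE ?addr_ge0 ?sqrtC_ge0 ?sqn_ge0 //.
rewrite sqrtCK expr2; apply: h => b.
by rewrite -expr2 sqrtCK.
Qed.

Lemma hs_cols I J (A : op R I J) : hs A = \sum_j sqn (fun i => A i j).
Proof.
rewrite /hs /sqn -(pair_bigA _ (fun i j => `|A i j| ^+ 2)) /=.
by rewrite exchange_big.
Qed.

Lemma sqn_mean_le (K : nat) I (v : 'I_K -> I -> C) (a b : 'I_K -> C) :
  (forall x, 0 <= a x) -> (forall x, 0 <= b x) ->
  (forall x, sqn (v x) <= a x * b x) ->
  sqn (fun i => K%:R^-1 * \sum_x v x i) <=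
  K%:R^-1 ^+ 2 * ((\sum_x a x) * (\sum_x b x)).
Proof.
move=> a0 b0 h; rewrite sqnZ ger0_norm ?invr_ge0 ?ler0n //.
by rewrite ler_wpM2l ?exprn_ge0 ?invr_ge0 ?ler0n // sqn_sum_le.
Qed.

End SqnExtra.

Section Test.
Variable R : realType.
Notation C := R[i].
Variables (A B E : finType) (K : nat).
Variables (G : 'I_K -> op R A A) (L : 'I_K -> op R B B).
Variable W : 'I_K -> op R (B * A)%type E.

(** Read as a vector, [G x] purifies the input state; this is the unnormalized joint vector of
    receiver and purifying system after the Kraus operator [P] and the measurement operator
    [L x]. *)
Definition steered x (P : op R B A) : op R B A := opmul (opmul (L x) P) (G x).

(** The mean over messages is taken before squaring, which keeps the test linear in [P]. *)
Definition privacy_test (P : op R B A) (f : E) : C :=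
  K%:R^-1 * \sum_(x < K) opv (fun f s => W x s f) (fun s => steered x P s.1 s.2) f.

Hypothesis K0 : (0 < K)%N.
Hypothesis Gn : forall x, hs (G x) = 1.
Hypothesis Ln : forall i j, \sum_x opmul (adj (L x)) (L x) i j = @idop R B i j.
Hypothesis Wc : forall x, contractive (fun f s => W x s f).

Lemma sum_sqn_povm v : \sum_x sqn (opv (L x) v) = sqn v.
Proof.
under eq_bigr => x _ do rewrite sqn_opv.
rewrite exchange_big /= -sum_idop_quad; apply: eq_bigr => j _.
rewrite exchange_big /=; apply: eq_bigr => k _.
by rewrite -mulr_suml -mulr_sumr Ln.
Qed.

Lemma sum_hs_povm (J : finType) (Y : op R B J) : \sum_x hs (opmul (L x) Y) = hs Y.
Proof.
under eq_bigr => x _ do rewrite hs_cols.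
rewrite exchange_big /= hs_cols; apply: eq_bigr => j _.
exact: (sum_sqn_povm (fun i => Y i j)).
Qed.

Let Knz : K%:R != 0 :> C. Proof. by rewrite pnatr_eq0 -lt0n. Qed.

(** The squared norm of the mean is at most the mean of the squared norms, and the contractions only
    decrease them. Then |L_x P G_x|^2 is one term of the sum over outcomes [y] of |L_y P G_x|^2,
    which is |P G_x|^2 = 1. *)
Lemma privacy_test_le1 P : opmul (adj P) P = @idop R A -> sqn (privacy_test P) <= 1.
Proof.
move=> PP.
apply: le_trans (sqn_mean_le (a := fun=> 1) (b := fun x => hs (steered x P)) _ _ _) _.
- by move=> x; rewrite ler01.
- by move=> x; apply: sqn_ge0.
- by move=> x; rewrite mul1r; apply: Wc.
rewrite sumr_const card_ord expr2 mulrA -[_ * _ * K%:R]mulrA mulVf // mulr1.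
rewrite mulrC ler_pdivrMr ?ltr0n // mul1r.
apply: (@le_trans _ _ (\sum_(x < K) 1)); last by rewrite sumr_const card_ord.
apply: ler_sum => x _.
have <- : \sum_y hs (opmul (L y) (opmul P (G x))) = 1.
  by rewrite sum_hs_povm hs_trace adjM -!opmulA (opmulA (adj P)) PP opmul1l -hs_trace.
rewrite (bigD1 x) //= /steered -opmulA lerDl.
by apply: sumr_ge0 => y _; apply: sqn_ge0.
Qed.

(** For P = u w^* the squared norm of L_x P G_x factors as |w^* G_x|^2 |L_x u|^2, and Cauchy-Schwarz
    over [x] separates the factors. The second sums to 1 over [x] by completeness of the
    measurement; the first sums to 1 over [c] for each of the [K] messages, leaving K^-2 K. *)
Lemma privacy_test_rank1 (S : finType) (u : S -> B -> C) (w : S -> A -> C) :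
  (forall c, sqn (u c) = 1) ->
  (forall a a', \sum_c w c a * (w c a')^* = (a == a')%:R) ->
  \sum_c sqn (privacy_test (fun b a => u c b * (w c a)^*)) <= K%:R^-1.
Proof.
move=> un wn.
pose al c x := sqn (fun j => \sum_a (w c a)^* * G x a j).
have cb c : sqn (privacy_test (fun b a => u c b * (w c a)^*)) <=
    K%:R^-1 ^+ 2 * ((\sum_x al c x) * (\sum_x sqn (opv (L x) (u c)))).
  apply: sqn_mean_le => x; rewrite ?sqn_ge0 //.
  apply: le_trans (Wc _ _) _; rewrite le_eqVlt; apply/orP; left; apply/eqP.
  rewrite /al /sqn mulrC big_distrlr pair_bigA /=.
  apply: eq_bigr => -[b j] _ /=; rewrite -exprMn -normrM; congr (`|_| ^+ 2).
  rewrite /steered /opv /opmul mulr_sumr; apply: eq_bigr => a _.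
  by rewrite mulrA; congr (_ * _); rewrite mulr_suml; apply: eq_bigr => b' _; rewrite mulrA.
apply: le_trans (ler_sum _ (fun c _ => cb c)) _; rewrite -mulr_sumr.
under eq_bigr => c _ do rewrite sum_sqn_povm un mulr1.
rewrite exchange_big /= (eq_bigr (fun=> 1)) => [|x _].
  by rewrite sumr_const card_ord expr2 -mulrA mulVf // mulr1.
rewrite -(Gn x) hs_cols /al /sqn exchange_big /=; apply: eq_bigr => j _.
apply: (sqn_isometry (A := fun c a => (w c a)^*) (fun a => G x a j)).
apply: opP => a a'; rewrite /opmul /idop -wn.
by apply: eq_bigr => c _; rewrite /adj conjCK.
Qed.

End Test.

(** * Fidelity of the privacy test with the square root of Eve's state *)

Section Steering.
Variable R : realType.
Notation C := R[i].
Variables (A B E : finType) (K : nat).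
Variables (G : 'I_K -> op R A A) (L : 'I_K -> op R B B) (V : E -> op R B A).
Hypothesis K0 : (0 < K)%N.

(** With the environment as row index, S_x times its adjoint is, for a code, Eve's unnormalized
    state when [x] is sent and decoded correctly. *)
Definition steer_op x : op R E (B * A)%type := fun e s => steered G L x (V e) s.1 s.2.

(** Polar decomposition makes the tests of all [V e] into the mean [N] of the square roots Q_x.
    Powers-Stormer and convexity put [N] within squared distance [eps] of the square root of [tau],
    a unit vector, and the triangle inequality concludes. The closeness hypothesis is stated through
    sign operators [X x], the form that Powers-Stormer consumes. *)
Lemma privacy_test_fidelity (tau : op R E E) (eps : C) :
  0 <= eps -> psd tau -> trace tau = 1 ->
  (forall X : 'I_K -> op R E E, (forall x, adj (X x) = X x) ->
     (forall x, opmul (X x) (X x) = @idop R E) ->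
     \sum_x K%:R^-1 * trace (opmul (X x) (opsub (opmul (steer_op x) (adj (steer_op x))) tau))
       <= eps) ->
  exists W : 'I_K -> op R (B * A)%type E,
    (forall x, contractive (fun f s => W x s f)) /\
    1 - sqrtC eps <= sqrtC (\sum_e sqn (privacy_test G L W (V e))).
Proof.
move=> e0 taup tau1 hX.
have [Qt Qtp QtE] := psd_sqrt taup.
have po x := polar (steer_op x).
pose W x := projT1 (cid (po x)).
have hW x : exists Q : op R E E,
  [/\ contractive (fun i j => W x j i), psd Q,
      opmul Q Q = opmul (steer_op x) (adj (steer_op x)) & opmul (steer_op x) (W x) = Q].
  exact: projT2 (cid (po x)).
pose Q x := projT1 (cid (hW x)).
have hQ x : [/\ contractive (fun i j => W x j i), psd (Q x),
      opmul (Q x) (Q x) = opmul (steer_op x) (adj (steer_op x)) & opmul (steer_op x) (W x) = Q x].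
  exact: projT2 (cid (hW x)).
have ps x : exists X : op R E E, [/\ adj X = X, opmul X X = @idop R E &
    hs (opsub (Q x) Qt) <= trace (opmul X (opsub (opmul (Q x) (Q x)) (opmul Qt Qt)))].
  by apply: powers_stormer => //; case: (hQ x).
exists W; split; first by move=> x; case: (hQ x).
pose X x := projT1 (cid (ps x)).
have hX' x : [/\ adj (X x) = X x, opmul (X x) (X x) = @idop R E &
    hs (opsub (Q x) Qt) <= trace (opmul (X x) (opsub (opmul (Q x) (Q x)) (opmul Qt Qt)))].
  exact: projT2 (cid (ps x)).
have Knz : K%:R != 0 :> C by rewrite pnatr_eq0 -lt0n.
have K1 : 0 <= K%:R^-1 :> C by rewrite invr_ge0 ler0n.
have le1 : \sum_x K%:R^-1 * hs (opsub (Q x) Qt) <= eps.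
  apply: le_trans (hX X _ _) => [|x|x]; try by case: (hX' x).
  apply: ler_sum => x _; rewrite ler_wpM2l //.
  by case: (hX' x) => _ _; case: (hQ x) => _ _ -> _; rewrite QtE.
(* Row [e] of [N] is the test of [V e], since [steer_op x] times [W x] is [Q x]. *)
pose N : op R E E := fun e f => K%:R^-1 * \sum_x Q x e f.
have -> : \sum_e sqn (privacy_test G L W (V e)) = hs N.
  rewrite /hs /sqn -(pair_bigA _ (fun i j => `|N i j| ^+ 2)) /=.
  apply: eq_bigr => e _; apply: eq_bigr => f _; congr (`|_ * _| ^+ 2).
  apply: eq_bigr => x _; case: (hQ x) => _ _ _ <-.
  by apply: eq_bigr => s _; rewrite mulrC.
have hsN : hs (opsub N Qt) <= eps.
  apply: le_trans le1.
  have -> : hs (opsub N Qt) =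
      sqn (fun ij : E * E => K%:R^-1 * \sum_x opsub (Q x) Qt ij.1 ij.2).
    congr sqn; apply: funext => -[e f] /=.
    rewrite /opsub sumrB mulrBr sumr_const card_ord; congr (_ - _).
    by rewrite -(mulr_natl (Qt e f)) mulrA mulVf // mul1r.
  apply: le_trans (sqn_mean_le (a := fun=> 1) (b := fun x => hs (opsub (Q x) Qt)) _ _ _) _.
  - by move=> x; rewrite ler01.
  - by move=> x; apply: sqn_ge0.
  - by move=> x; rewrite mul1r.
  by rewrite sumr_const card_ord expr2 mulrA -[_ * _ * K%:R]mulrA mulVf // mulr1 mulr_sumr.
have hsQ : hs Qt = 1 by rewrite hs_trace (psd_adj Qtp) QtE.
have := sqrt_sqn_triangle (fun ij : E * E => N ij.1 ij.2) (fun ij : E * E => opsub Qt N ij.1 ij.2).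
have -> : (fun i : E * E => N i.1 i.2 + opsub Qt N i.1 i.2) = (fun i => Qt i.1 i.2).
  by apply: funext => -[e f] /=; rewrite /opsub addrC subrK.
rewrite -!/(hs _) hsQ sqrtC1 lerBlDr => h; apply: le_trans h _.
rewrite lerD2l ler_sqrtC ?nnegrE ?sqn_ge0 //.
have <- : hs (opsub N Qt) = hs (opsub Qt N).
  by apply: eq_bigr => -[e f] _ /=; rewrite /opsub distrC.
by [].
Qed.

End Steering.

(** * Key codes *)

Section KeyCode.
Variable R : realType.
Notation C := R[i].

Lemma sum_triple (I J T : finType) (F : I * (J * T) -> C) :
  \sum_i F i = \sum_x \sum_y \sum_e F (x, (y, e)).
Proof.
rewrite (eq_bigr (fun i => F (i.1, i.2))) => [|[]//].
rewrite -(pair_bigA _ (fun x ye => F (x, ye))) /=; apply: eq_bigr => x _.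
rewrite (eq_bigr (fun i => F (x, (i.1, i.2)))) => [|[]//].
by rewrite -(pair_bigA _ (fun y e => F (x, (y, e)))).
Qed.

Lemma sum_ffun_prod (n : nat) (T : finType) (F : 'I_n -> T -> C) :
  \sum_(f : {ffun 'I_n -> T}) \prod_k F k (f k) = \prod_k \sum_t F k t.
Proof. by rewrite bigA_distr_bigA. Qed.

Lemma prod_delta (n : nat) (T : finType) (f g : {ffun 'I_n -> T}) :
  \prod_k (f k == g k)%:R = (f == g)%:R :> C.
Proof.
have [->|/eqP fg] := eqVneq f g; first by rewrite big1 // => k _; rewrite eqxx.
have [k fgk] : exists k, f k != g k.
  apply/existsP; rewrite -negb_forall; apply/negP => /forallP h; apply: fg.
  by apply/ffunP => k; apply/eqP.
by rewrite (bigD1 k) //= (negbTE fgk) mul0r.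
Qed.

(** The operator sum_x |x><x| (x) |x><x| (x) X_x, which vanishes where the decoded value differs
    from the key. It joins one test operator per message into a single contraction. *)
Definition block_key (K : nat) (T : finType) (X : 'I_K -> op R T T) :
    op R ('I_K * ('I_K * T))%type ('I_K * ('I_K * T))%type :=
  fun i j => (i.1 == j.1)%:R * ((i.2.1 == j.2.1)%:R * ((i.1 == i.2.1)%:R * X i.1 i.2.2 j.2.2)).

Lemma block_key_contractive (K : nat) (T : finType) (X : 'I_K -> op R T T) :
  (forall x, contractive (X x)) -> contractive (block_key X).
Proof.
move=> Xc v; rewrite /sqn !sum_triple; apply: ler_sum => x _; apply: ler_sum => y _.
have vE e : opv (block_key X) v (x, (y, e)) =
    (x == y)%:R * opv (X x) (fun e' => v (x, (y, e'))) e.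
  rewrite /opv /block_key sum_triple /= mulr_sumr.
  under eq_bigr => x' _.
    under eq_bigr => y' _ do under eq_bigr => e' _ do rewrite -!mulrA.
    under eq_bigr => y' _ do rewrite -!mulr_sumr mulrCA.
    rewrite sum_deltal.
    over.
  by rewrite sum_deltal mulr_sumr.
under eq_bigr => e _ do rewrite vE.
case: eqP => _.
  under eq_bigr => e _ do rewrite mul1r.
  exact: (Xc x (fun e => v (x, (y, e)))).
rewrite big1 => [|e _]; last by rewrite mul0r normr0 expr0n.
exact: (sqn_ge0 (fun e => v (x, (y, e)))).
Qed.

Lemma trace_block_key (K : nat) (T : finType) (X : 'I_K -> op R T T)
    (D : op R ('I_K * ('I_K * T))%type ('I_K * ('I_K * T))%type) :
  trace (opmul (adj (block_key X)) D) =
  \sum_x trace (opmul (adj (X x)) (fun e e' => D (x, (x, e)) (x, (x, e')))).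
Proof.
rewrite /trace sum_triple; apply: eq_bigr => x _.
transitivity (\sum_y (x == y)%:R * \sum_e \sum_e' (X x e' e)^* * D (x, (y, e')) (x, (y, e))).
  apply: eq_bigr => y _; rewrite mulr_sumr; apply: eq_bigr => e _.
  rewrite /opmul /adj /block_key sum_triple /= (bigD1 x) //= [X in _ + X]big1 ?addr0; last first.
    move=> x' nx; apply: big1 => y' _; apply: big1 => e' _.
    by rewrite (negbTE nx) mul0r rmorph0 mul0r.
  rewrite (bigD1 y) //= [X in _ + X]big1 ?addr0; last first.
    move=> y' ny; apply: big1 => e' _.
    by rewrite (negbTE ny) mul0r mulr0 rmorph0 mul0r.
  rewrite mulr_sumr; apply: eq_bigr => e' _.
  by rewrite !eqxx !mul1r rmorphM /= rmorph_nat mulrA.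
by rewrite sum_deltal.
Qed.

Section OneCode.
Variables (A B E : finType) (V : op R (B * E)%type A) (n K : nat).
Notation An := (nfold n A). Notation Bn := (nfold n B). Notation En := (nfold n E).
Let Vn := @isom_pow R A B E n V.

Definition kraus (e : En) : op R Bn An := fun b a => Vn (b, e) a.

Hypothesis Viso : Defs.isometry V.

Lemma kraus_isometry a a' :
  \sum_e \sum_b (kraus e b a)^* * kraus e b a' = (a == a')%:R.
Proof.
rewrite -prod_delta.
transitivity (\sum_(e : {ffun 'I_n -> E}) \prod_k \sum_b (V (b, e k) (a k))^* * V (b, e k) (a' k)).
  apply: eq_bigr => e _.
  rewrite -(sum_ffun_prod (fun k t => (V (t, e k) (a k))^* * V (t, e k) (a' k))).
  apply: eq_bigr => b _.
  by rewrite /kraus /Vn /isom_pow rmorph_prod -big_split.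
rewrite (sum_ffun_prod (fun k t => \sum_b (V (b, t) (a k))^* * V (b, t) (a' k))).
apply: eq_bigr => k _; rewrite -[RHS]/(@idop R A (a k) (a' k)) -Viso.
rewrite /opmul exchange_big (pair_bigA _ (fun b e => (V (b, e) (a k))^* * V (b, e) (a' k))) /=.
by apply: eq_bigr => -[].
Qed.

Lemma sum_hs_kraus (J : finType) (Y : op R An J) : \sum_e hs (opmul (kraus e) Y) = hs Y.
Proof.
under eq_bigr => e _ do rewrite hs_cols.
rewrite exchange_big /= hs_cols; apply: eq_bigr => j _.
transitivity (\sum_e sqn (opv (kraus e) (fun a => Y a j))); first by [].
under eq_bigr => e _ do rewrite sqn_opv.
rewrite exchange_big /= -(sum_idop_quad (fun i => Y i j)); apply: eq_bigr => a _.
rewrite exchange_big /=; apply: eq_bigr => a' _.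
by rewrite -mulr_suml -mulr_sumr kraus_isometry.
Qed.

Variables (rho : 'I_K -> op R An An) (M : 'I_K -> op R Bn Bn).
Variables (G : 'I_K -> op R An An) (L : 'I_K -> op R Bn Bn).
Hypothesis rhoG : forall x, rho x = opmul (G x) (adj (G x)).
Hypothesis ML : forall x, M x = opmul (adj (L x)) (L x).
Hypothesis K0 : (0 < K)%N.
Hypothesis Gn : forall x, hs (G x) = 1.

Lemma rhoXBE_diag x b e b' e' :
  rhoXBE V rho (x, (b, e)) (x, (b', e')) =
  K%:R^-1 * \sum_j opmul (kraus e) (G x) b j * (opmul (kraus e') (G x) b' j)^*.
Proof.
rewrite /rhoXBE; congr (_ * _).
rewrite (eq_bigr (fun z => (x == z)%:R * opmul (opmul Vn (rho z)) (adj Vn) (b, e) (b', e'))).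
  rewrite sum_deltal rhoG opmulA -opmulA -adjM; apply: eq_bigr => j _.
  by [].
by move=> z _; rewrite /tens /Defs.proj /= andbb.
Qed.

(** One factor of M_x = L_x^* L_x goes to each side of the state, which exhibits Eve's conditional
    state as a Gram operator, ready for [polar]. *)
Lemma measured_state_diag x e e' :
  measured_state V rho M (x, (x, e)) (x, (x, e')) =
  K%:R^-1 * opmul (steer_op G L kraus x) (adj (steer_op G L kraus x)) e e'.
Proof.
rewrite /measured_state eqxx mul1r.
under eq_bigr => b _ do under eq_bigr => b' _ do rewrite rhoXBE_diag mulrCA.
under eq_bigr => b _ do rewrite -mulr_sumr.
rewrite -mulr_sumr; congr (_ * _).
rewrite [RHS](eq_bigr (fun s => steered G L x (kraus e) s.1 s.2 * (steered G L x (kraus e') s.1 s.2)^*)) //.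
rewrite -(pair_bigA _ (fun c j => steered G L x (kraus e) c j * (steered G L x (kraus e') c j)^*)) /=.
rewrite [RHS]exchange_big /=.
under eq_bigr => b _ do under eq_bigr => b' _ do rewrite mulr_sumr.
under eq_bigr => b _ do rewrite exchange_big /=.
rewrite exchange_big /=; apply: eq_bigr => j _.
rewrite /steered -!opmulA.
set Y := opmul (kraus e) (G x); set Y' := opmul (kraus e') (G x).
rewrite /(opmul (L x)).
under [RHS]eq_bigr => c _ do rewrite rmorph_sum big_distrlr /= exchange_big /=.
rewrite [RHS]exchange_big /=; apply: eq_bigr => b _.
rewrite [RHS]exchange_big /=; apply: eq_bigr => b' _.
rewrite ML /opmul mulr_suml; apply: eq_bigr => c _.
by rewrite /adj rmorphM /=; ring.
Qed.

(** [T] gathers the amplitudes of all messages, outputs and purifying indices, with 1/K split as a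
    square root; its Hilbert-Schmidt norm gives the trace. *)
Lemma rhoE_factor : exists T : op R En ('I_K * (Bn * An))%type,
  rhoE V rho = opmul T (adj T) /\ trace (rhoE V rho) = 1.
Proof.
pose c : C := sqrtC K%:R^-1.
have cc : c * c^* = K%:R^-1.
  by rewrite conj_Creal ?ger0_real ?sqrtC_ge0 ?invr_ge0 ?ler0n // -expr2 sqrtCK.
pose T : op R En ('I_K * (Bn * An))%type :=
  fun e s => c * opmul (kraus e) (G s.1) s.2.1 s.2.2.
have E1 : rhoE V rho = opmul T (adj T).
  apply: opP => e e'; rewrite /rhoE /opmul sum_triple; apply: eq_bigr => x _.
  apply: eq_bigr => b _; rewrite rhoXBE_diag mulr_sumr; apply: eq_bigr => j _.
  by rewrite /adj /T /= rmorphM -cc /=; ring.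
exists T; split => //; rewrite E1.
transitivity (hs T).
  by rewrite /hs sqnE -(pair_bigA _ (fun i j => T i j * (T i j)^*)).
rewrite /hs /sqn -(pair_bigA _ (fun i j => `|T i j| ^+ 2)) /=.
under eq_bigr => e _ do rewrite sum_triple.
rewrite exchange_big /= (eq_bigr (fun=> K%:R^-1)) => [|x _].
  by rewrite sumr_const card_ord -[_ *+ K]mulr_natr mulVf // pnatr_eq0 -lt0n.
transitivity (K%:R^-1 * hs (G x)); last by rewrite Gn mulr1.
rewrite -sum_hs_kraus mulr_sumr; apply: eq_bigr => e _.
rewrite /hs /sqn mulr_sumr pair_bigA; apply: eq_bigr => -[b j] _ /=.
by rewrite /T /= normrM exprMn; congr (_ * _); rewrite normCK.
Qed.

(** The closeness hypothesis of [privacy_test_fidelity] is the pairing of [block_key X] with the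
    difference of measured and ideal states, so the trace norm bounds it. *)
Lemma key_code_fidelity (eps : R) : 0 < eps ->
  trnorm (fun i j => measured_state V rho M i j - ideal_state V rho i j) < eps ->
  exists W : 'I_K -> op R (Bn * An)%type En,
    (forall x, contractive (fun f s => W x s f)) /\
    1 - sqrtC (eps%:C)%C <= sqrtC (\sum_e sqn (privacy_test G L W (kraus e))).
Proof.
move=> e0 he; have [T [rE tr1]] := rhoE_factor.
apply: (@privacy_test_fidelity _ _ _ _ _ G L kraus K0 (rhoE V rho)) => //.
- by rewrite ler0c ltW.
- by rewrite rE; apply: psd_gram.
move=> X Xa XX.
pose D i j := measured_state V rho M i j - ideal_state V rho i j.
apply: (@le_trans _ _ (trnorm D)%:C%C); last first.
  by rewrite lecR ltW.
have Xc : contractive (block_key X).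
  apply: block_key_contractive => x; apply: isometry_contractive.
  by rewrite Xa.
have h := norm_trace_le_trnorm D Xc; apply: (le_trans _ h).
rewrite trace_block_key.
set S1 := (X in X <= _); set S2 := (X in _ <= `|X|).
have -> : S2 = S1.
  apply: eq_bigr => x _; rewrite Xa /trace mulr_sumr; apply: eq_bigr => e _.
  rewrite /opmul mulr_sumr; apply: eq_bigr => e' _.
  rewrite /D measured_state_diag /opsub mulrCA; congr (_ * _).
  rewrite mulrBr; congr (_ - _); rewrite /ideal_state; congr (_ * _).
  rewrite (eq_bigr (fun z => (x == z)%:R * ((x == z)%:R * rhoE V rho e' e))).
    by rewrite sum_deltal eqxx mul1r.
  by move=> z _; rewrite /tens /Defs.proj /= !andbb.
(* The sum is real, hence below its modulus: each term is the trace of a product of two Hermitian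
   operators. *)
apply: real_ler_norm; rewrite /S1; apply: rpred_sum => x _.
apply: rpredM; first by rewrite ger0_real ?invr_ge0 ?ler0n.
rewrite CrealE; apply/eqP.
set Z := opsub _ _.
have Za : adj Z = Z.
  rewrite /Z; have := psd_adj (psd_gram (steer_op G L kraus x)).
  have rEa : adj (rhoE V rho) = rhoE V rho by rewrite rE; apply/psd_adj/psd_gram.
  move=> h1; rewrite -{2}h1 -{2}rEa; apply: opP => e e'.
  by rewrite /adj /opsub rmorphB.
transitivity (trace (adj (opmul (X x) Z))); first by rewrite /trace rmorph_sum.
by rewrite adjM Za Xa traceC.
Qed.

End OneCode.
End KeyCode.

(** * Pauli channels *)

Section Kraus.
Variable R : realType.
Notation C := R[i].

Lemma opmul_adjE (I J : finType) (P : op R I J) (rho : op R J J) (Q : op R I J) b b' :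
  opmul (opmul P rho) (adj Q) b b' =
  \sum_a \sum_a' rho a a' * (P b a * (Q b' a')^*).
Proof.
rewrite /opmul /adj exchange_big /=; apply: eq_bigr => a' _.
by rewrite mulr_suml; apply: eq_bigr => a _; ring.
Qed.

Lemma pure_density (I : finType) (u : I -> C) : sqn u = 1 ->
  density (fun i j => u i * (u j)^*).
Proof.
move=> u1; split; last by rewrite -u1 sqnE.
have -> : (fun i j => u i * (u j)^*) = opmul (fun i (_ : unit) => u i) (adj (fun i (_ : unit) => u i)).
  by apply: opP => i j; rewrite /opmul /adj big_const card_unit /= addr0.
exact: psd_gram.
Qed.

(** An isometric extension is specified on density operators only. Normalized pure states already
    determine a quadratic form, and polarization its entries; the zero vector is treated apart. *)
Lemma density_separating (I : finType) (F : op R I I) :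
  (forall rho, density rho -> \sum_a \sum_a' rho a a' * F a a' = 0) ->
  forall a a', F a a' = 0.
Proof.
move=> h; pose A : op R I I := fun i j => F j i.
have q (u : I -> C) : \sum_i \sum_j (u i)^* * A i j * u j = 0.
  have [u0|un] := eqVneq (sqn u) 0.
    have {}u0 i : u i = 0.
      apply/eqP; rewrite -normr_eq0 -sqrf_eq0; apply/eqP.
      by move: u0 => /eqP; rewrite psumr_eq0 => [/allP/(_ i)/(_ (mem_index_enum _))/eqP //|j _]; rewrite exprn_ge0.
    by apply: big1 => i _; apply: big1 => j _; rewrite !u0 mulr0.
  pose r := (sqrtC (sqn u))^-1.
  have r0 : r != 0 by rewrite invr_neq0 // sqrtC_eq0.
  have rr : r * r * sqn u = 1 by rewrite /r -invfM -expr2 sqrtCK mulVf.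
  have rge : 0 <= r by rewrite invr_ge0 sqrtC_ge0 sqn_ge0.
  have s1 : sqn (fun i => r * u i) = 1 by rewrite sqnZ ger0_norm // expr2.
  have := h _ (pure_density s1).
  have -> : \sum_a \sum_a' r * u a * (r * u a')^* * F a a' =
      (r * r) * \sum_i \sum_j (u i)^* * A i j * u j.
    rewrite mulr_sumr exchange_big /=; apply: eq_bigr => i _; rewrite mulr_sumr.
    apply: eq_bigr => j _; rewrite rmorphM /= (conj_Creal (ger0_real rge)) /A; ring.
  by move/eqP; rewrite !mulf_eq0 (negbTE r0) => /eqP.
have q1 k l c : A k k + A k l * c + c^* * A l k + c^* * A l l * c = 0.
  by rewrite -quadratic_pair; apply: q.
have d k : A k k = 0.
  by have := q1 k k 0; rewrite rmorph0 !mul0r !mulr0 !addr0.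
move=> l k; rewrite -[F l k]/(A k l).
have h1 := q1 k l 1; have h2 := q1 k l 'i.
rewrite rmorph1 conjCi !d in h1 h2.
have {}h1 : A l k = - A k l by apply/eqP; rewrite -addr_eq0 -h1; apply/eqP; ring.
have i0 := neq0Ci C.
have : 2%:R * 'i * A k l = 0 by rewrite -h2 h1; ring.
by move/eqP; rewrite !mulf_eq0 pnatr_eq0 (negbTE i0) => /eqP.
Qed.

(** The test is linear in [P], so its weighted second moment depends on the family [P] only through
    its Choi matrix. Kraus families of the same map can thus be exchanged. *)
Lemma sum_sqn_privacy_test (A B E T : finType) (K : nat)
  (G : 'I_K -> op R A A) (L : 'I_K -> op R B B) (W : 'I_K -> op R (B * A)%type E)
  (c : T -> C) (P : T -> op R B A) :
  \sum_t c t * sqn (privacy_test G L W (P t)) =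
  \sum_f \sum_(s : B * A) \sum_(s' : B * A)
    (K%:R^-1 * \sum_x \sum_s0 W x s0 f * (L x s0.1 s.1 * G x s.2 s0.2)) *
    (K%:R^-1 * \sum_x \sum_s0 W x s0 f * (L x s0.1 s'.1 * G x s'.2 s0.2))^* *
    \sum_t c t * (P t s.1 s.2 * (P t s'.1 s'.2)^*).
Proof.
pose kap f (s : B * A) := K%:R^-1 * \sum_x \sum_s0 W x s0 f * (L x s0.1 s.1 * G x s.2 s0.2).
have pE t f : privacy_test G L W (P t) f = \sum_(s : B * A) kap f s * P t s.1 s.2.
  rewrite /privacy_test /opv /steered.
  under [RHS]eq_bigr => s _ do rewrite -mulrA mulr_suml.
  rewrite -mulr_sumr; congr (_ * _); rewrite [RHS]exchange_big /=; apply: eq_bigr => x _.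
  under [RHS]eq_bigr => s _ do rewrite mulr_suml.
  rewrite [RHS]exchange_big /=; apply: eq_bigr => s0 _.
  under [RHS]eq_bigr => s _ do rewrite -mulrA.
  rewrite -mulr_sumr; congr (_ * _).
  rewrite -(pair_bigA _ (fun b a => L x s0.1 b * G x a s0.2 * P t b a)) /= exchange_big /=.
  rewrite /opmul; apply: eq_bigr => a _; rewrite mulr_suml; apply: eq_bigr => b _; ring.
under eq_bigr => t _ do rewrite sqnE mulr_sumr.
rewrite exchange_big /=; apply: eq_bigr => f _.
under eq_bigr => t _ do rewrite pE rmorph_sum big_distrlr /= mulr_sumr.
rewrite exchange_big /=; apply: eq_bigr => s _.
under eq_bigr => t _ do rewrite mulr_sumr.
rewrite exchange_big /=; apply: eq_bigr => s' _.
rewrite mulr_sumr; apply: eq_bigr => t _; rewrite rmorphM /= -/(kap f s) -/(kap f s').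
ring.
Qed.

End Kraus.

(** * Pauli operators and the one-qubit channel *)

Section Pauli.
Variable R : realType.
Notation C := R[i].

Definition pauli (i : 'I_3) : op R 'I_2 'I_2 :=
  if val i == 0%N then @pauliX R else if val i == 1%N then @pauliY R else @pauliZ R.

Definition pauli_pow (i : 'I_3) (s : bool) : op R 'I_2 'I_2 :=
  if s then pauli i else @idop R 'I_2.

Let rt : C := sqrtC 2%:R^-1.

(** A unit eigenvector of sigma_i, for the eigenvalue 1 if [c] is false and -1 if [c] is true. *)
Definition pauli_eigvec (i : 'I_3) (c : bool) (b : 'I_2) : C :=
  if val i == 2%N then (b == (if c then 1 else 0))%:R
  else rt * (if b == 0 then 1 else (if c then -1 else 1) * (if val i == 0%N then 1 else 'i)).

Lemma pauli_eigvecE i c b a :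
  pauli_eigvec i c b * (pauli_eigvec i c a)^* =
  2%:R^-1 * (@idop R _ b a + (if c then -1 else 1) * pauli i b a).
Proof.
have rr : rt * rt = 2%:R^-1 by rewrite -expr2 sqrtCK.
have rc : rt^* = rt by rewrite conj_Creal // ger0_real // sqrtC_ge0 invr_ge0 ler0n.
have ii : 'i * 'i = -1 :> C by rewrite -expr2 sqrCi.
case: i => [[|[|[|//]]] hi]; case: c; case: b => [[|[|//]] hb]; case: a => [[|[|//]] ha];
 rewrite /pauli_eigvec /pauli /idop /pauliX /pauliY /pauliZ /= -?(inj_eq val_inj) /=
   ?rmorphM ?rmorphN ?rmorph1 ?rmorph0 ?conjCi ?rc /= ?mulr1n ?mulr0n
   ?mulr1 ?mul1r ?mulr0 ?mul0r ?addr0 ?add0r ?subrr ?mulr0 //; rewrite -?rr; rewrite ?complexiE ?rc ?rmorphM ?rmorphN ?rmorph1 /= ?rc ?conjCi; try ring.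
 all: try (rewrite ?mulrN ?mulNr ?mul1r ?mulr1 ?opprK -?mulrA ?(mulrCA _ rt) ?ii; ring: ii).
all: by rewrite rr; field.
Qed.

(** Equality of Choi matrices: a fair mixture of the identity and sigma_i is complete dephasing in
    the eigenbasis. With the projections (1 + sigma_i)/2 and (1 - sigma_i)/2 the cross terms
    cancel. *)
Lemma pauli_dephasing i b a b' a' :
  \sum_(s : bool) 2%:R^-1 * (pauli_pow i s b a * (pauli_pow i s b' a')^*) =
  \sum_(c : bool) pauli_eigvec i c b * (pauli_eigvec i c a)^* *
     (pauli_eigvec i c b' * (pauli_eigvec i c a')^*)^*.
Proof.
rewrite !big_bool /= !pauli_eigvecE !rmorphM !rmorphD !rmorphM !rmorphN !rmorph1 /= !mulN1r !mul1r.
have -> : (2%:R^-1)^* = 2%:R^-1 :> C by rewrite conj_Creal // ger0_real // invr_ge0 ler0n.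
by field.
Qed.

Lemma pauli_eigvec_complete i b a :
  \sum_(c : bool) pauli_eigvec i c b * (pauli_eigvec i c a)^* = (b == a)%:R.
Proof. by rewrite big_bool /= !pauli_eigvecE -/(@idop R _ b a); field. Qed.

Lemma pauli_trace0 i : \sum_b pauli i b b = 0.
Proof.
rewrite !big_ord_recl big_ord0 /pauli; case: i => [[|[|[|//]]] hi] /=;
  rewrite /pauliX /pauliY /pauliZ ?eqxx /= ?addr0 //.
by rewrite subrr.
Qed.

Lemma sqn_pauli_eigvec i c : sqn (pauli_eigvec i c) = 1.
Proof.
rewrite sqnE; under eq_bigr => b _ do rewrite pauli_eigvecE.
rewrite -mulr_sumr big_split /= -mulr_sumr pauli_trace0 mulr0 addr0.
by rewrite !big_ord_recl big_ord0 /idop !eqxx addr0 /=; field.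
Qed.

Lemma pauli_adj i : adj (pauli i) = pauli i.
Proof.
apply: opP => b a; rewrite /adj /pauli.
case: i => [[|[|[|//]]] hi] /=; case: b => [[|[|//]] hb]; case: a => [[|[|//]] ha];
  rewrite /pauliX /pauliY /pauliZ /= -?(inj_eq val_inj) /= ?complexiE
    ?rmorphN ?rmorph1 ?rmorph0 /= ?conjCi ?opprK //.
Qed.

Lemma pauli_sqr i : opmul (pauli i) (pauli i) = @idop R _.
Proof.
have ii : 'i * 'i = -1 :> C by rewrite -expr2 sqrCi.
apply: opP => b a; rewrite /opmul /pauli !big_ord_recl big_ord0 /idop.
case: i => [[|[|[|//]]] hi] /=; case: b => [[|[|//]] hb]; case: a => [[|[|//]] ha];
  rewrite /pauliX /pauliY /pauliZ /= -?(inj_eq val_inj) /= ?complexiE; ring: ii.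
Qed.

Lemma pauli_pow_unitary i s : opmul (adj (pauli_pow i s)) (pauli_pow i s) = @idop R _.
Proof.
case: s; rewrite /pauli_pow ?pauli_adj ?pauli_sqr //.
by rewrite opmul1r; apply: opP => b a; rewrite /adj /idop rmorph_nat eq_sym.
Qed.

(* If no error occurs (p = 0), any distribution over the axes will do. *)
Definition pauli_weight (p1 p2 p3 : R) (i : 'I_3) : R :=
  let p := p1 + p2 + p3 in
  if p == 0 then 3%:R^-1
  else (if val i == 0%N then p1 else if val i == 1%N then p2 else p3) / p.

Definition flip_weight (p : R) (s : bool) : R := if s then p else 1 - p.

Lemma pauli_weight_ge0 p1 p2 p3 i : 0 <= p1 -> 0 <= p2 -> 0 <= p3 ->
  0 <= pauli_weight p1 p2 p3 i.
Proof.
move=> h1 h2 h3; rewrite /pauli_weight; case: eqP => _; first by rewrite invr_ge0 ler0n.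
by apply: divr_ge0; [case: ifP => // _; case: ifP | rewrite !addr_ge0].
Qed.

Lemma sum_pauli_weight p1 p2 p3 : \sum_i pauli_weight p1 p2 p3 i = 1.
Proof.
rewrite !big_ord_recl big_ord0 /pauli_weight /=; case: eqP => [_|/eqP p0]; first by field.
by field.
Qed.

(** If the total error is 0, each nonnegative [p] is 0, so the default weight is harmless. *)
Lemma pauli_weightM p1 p2 p3 i : 0 <= p1 -> 0 <= p2 -> 0 <= p3 ->
  pauli_weight p1 p2 p3 i * (p1 + p2 + p3) =
  if val i == 0%N then p1 else if val i == 1%N then p2 else p3.
Proof.
move=> h1 h2 h3; rewrite /pauli_weight; case: eqP => [p0|/eqP p0]; last by rewrite mulfVK.
rewrite p0 mulr0; case: ifP => _; first lra.
by case: ifP => _; lra.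
Qed.

(** Both sides are Choi matrices of the channel; they agree by [density_separating], since both maps
    agree on density operators. *)
Lemma pauli_kraus (p1 p2 p3 : R) (E : finType) (V : op R ('I_2 * E)%type 'I_2) :
  0 <= p1 -> 0 <= p2 -> 0 <= p3 ->
  isometric_extension (@pauli_channel R p1 p2 p3) V ->
  forall b a b' a', \sum_e V (b, e) a * (V (b', e) a')^* =
    \sum_i (pauli_weight p1 p2 p3 i)%:C%C * \sum_(s : bool) (flip_weight (p1 + p2 + p3) s)%:C%C *
      (pauli_pow i s b a * (pauli_pow i s b' a')^*).
Proof.
move=> h1 h2 h3 [_ hV] b a b' a'.
apply/eqP; rewrite -subr_eq0; apply/eqP.
pose F : op R 'I_2 'I_2 := fun a a' => \sum_e V (b, e) a * (V (b', e) a')^* -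
   \sum_i (pauli_weight p1 p2 p3 i)%:C%C * \sum_(s : bool) (flip_weight (p1 + p2 + p3) s)%:C%C *
      (pauli_pow i s b a * (pauli_pow i s b' a')^*).
rewrite -/(F a a'); apply: density_separating => rho rd.
have := hV rho rd => /(congr1 (fun T : op R 'I_2 'I_2 => T b b')) /= hb.
rewrite /F; under eq_bigr => x _ do under eq_bigr => y _ do rewrite mulrBr.
under eq_bigr => x _ do rewrite sumrB.
rewrite sumrB; apply/eqP; rewrite subr_eq0; apply/eqP.
transitivity (ptrace2 (opmul (opmul V rho) (adj V)) b b').
  rewrite /ptrace2; under [RHS]eq_bigr => e _ do rewrite opmul_adjE.
  rewrite [RHS]exchange_big /=; apply: eq_bigr => x _.
  rewrite [RHS]exchange_big /=; apply: eq_bigr => y _.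
  by rewrite mulr_sumr.
rewrite hb.
transitivity (\sum_i (pauli_weight p1 p2 p3 i)%:C%C * \sum_(s : bool) (flip_weight (p1 + p2 + p3) s)%:C%C *
      opmul (opmul (pauli_pow i s) rho) (adj (pauli_pow i s)) b b'); last first.
  under eq_bigr => i _ do under eq_bigr => s _ do rewrite opmul_adjE mulr_sumr.
  under eq_bigr => i _ do rewrite exchange_big /= mulr_sumr.
  rewrite exchange_big /=; apply: eq_bigr => x _.
  under eq_bigr => i _ do under eq_bigr => s _ do rewrite mulr_sumr.
  under eq_bigr => i _ do rewrite exchange_big /= mulr_sumr.
  rewrite exchange_big /=; apply: eq_bigr => y _.
  rewrite mulr_sumr; apply: eq_bigr => i _.
  rewrite mulrCA; congr (_ * _); rewrite mulr_sumr; apply: eq_bigr => s _.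
  by rewrite mulrCA.
(* The flipped terms recover [p1], [p2], [p3]; the unflipped ones put total weight 1 - |p| on the
   identity, as the axis weights sum to 1. *)
under eq_bigr => i _ do rewrite big_bool /= mulrDr !mulrA -!rmorphM /= pauli_weightM //.
rewrite big_split /= addrC.
have id1 : adj (@idop R 'I_2) = @idop R 'I_2.
  by apply: opP => x y; rewrite /adj /idop rmorph_nat eq_sym.
under eq_bigr => i _ do rewrite rmorphM /= id1 opmul1l opmul1r -mulrA.
rewrite -mulr_suml -rmorph_sum /= sum_pauli_weight mul1r.
by rewrite !big_ord_recl big_ord0 /= !pauli_adj /pauli_channel addr0 !addrA.
Qed.

End Pauli.

(** * Pauli strings and the classical test extracted from a key code *)

Section NFold.
Variable R : realType.
Notation C := R[i].
Variable n : nat.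
Notation Qn := (nfold n 'I_2).
Implicit Types (i : {ffun 'I_n -> 'I_3}) (s c : {ffun 'I_n -> bool}).

Definition pauli_string i s : op R Qn Qn :=
  fun b a => \prod_k pauli_pow R (i k) (s k) (b k) (a k).

Definition eigvec_string i c (b : Qn) : C := \prod_k pauli_eigvec R (i k) (c k) (b k).

Lemma pauli_string_unitary i s :
  opmul (adj (pauli_string i s)) (pauli_string i s) = @idop R Qn.
Proof.
apply: opP => a a'; rewrite /idop -prod_delta /opmul /adj /pauli_string /=.
under eq_bigr => b _ do rewrite rmorph_prod -big_split /=.
rewrite (sum_ffun_prod (fun k t => (pauli_pow R (i k) (s k) t (a k))^* * pauli_pow R (i k) (s k) t (a' k))).
apply: eq_bigr => k _.
by rewrite -[RHS]/(@idop R 'I_2 (a k) (a' k)) -(pauli_pow_unitary R (i k) (s k)).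
Qed.

Lemma sqn_eigvec_string i c : sqn (eigvec_string i c) = 1.
Proof.
rewrite sqnE /eigvec_string /=; under eq_bigr => b _ do rewrite rmorph_prod -big_split /=.
rewrite (sum_ffun_prod (fun k t => pauli_eigvec R (i k) (c k) t * (pauli_eigvec R (i k) (c k) t)^*)).
by rewrite big1 // => k _; rewrite -sqnE sqn_pauli_eigvec.
Qed.

Lemma eigvec_string_complete i a a' :
  \sum_c eigvec_string i c a * (eigvec_string i c a')^* = (a == a')%:R.
Proof.
rewrite -prod_delta /eigvec_string /=.
under eq_bigr => c _ do rewrite rmorph_prod -big_split /=.
rewrite (sum_ffun_prod (fun k t => pauli_eigvec R (i k) t (a k) * (pauli_eigvec R (i k) t (a' k))^*)).
by apply: eq_bigr => k _; rewrite pauli_eigvec_complete.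
Qed.

Lemma pauli_string_dephasing i b a b' a' :
  \sum_s 2%:R^-1 ^+ n * (pauli_string i s b a * (pauli_string i s b' a')^*) =
  \sum_c 1 * (eigvec_string i c b * (eigvec_string i c a)^* *
     (eigvec_string i c b' * (eigvec_string i c a')^*)^*).
Proof.
transitivity (\prod_k \sum_s 2%:R^-1 * (pauli_pow R (i k) s (b k) (a k) * (pauli_pow R (i k) s (b' k) (a' k))^*)).
  rewrite -sum_ffun_prod; apply: eq_bigr => s _.
  by rewrite rmorph_prod !big_split /= prodr_const card_ord.
under eq_bigr => k _ do rewrite pauli_dephasing.
rewrite -sum_ffun_prod; apply: eq_bigr => c _.
rewrite mul1r /eigvec_string !rmorphM /= !rmorph_prod !big_split /=; congr (_ * _).
by rewrite -big_split; apply: eq_bigr => k _; rewrite rmorphM.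
Qed.

(** The one-qubit identity multiplied over all positions and expanded. The factor 1 is the weight
    that [sum_sqn_privacy_test] expects. *)
Lemma kraus_pauli_string (p1 p2 p3 : R) (E : finType) (V : op R ('I_2 * E)%type 'I_2) :
  0 <= p1 -> 0 <= p2 -> 0 <= p3 ->
  isometric_extension (@pauli_channel R p1 p2 p3) V ->
  forall b a b' a', \sum_(e : nfold n E) 1 * (kraus V e b a * (kraus V e b' a')^*) =
    \sum_(t : {ffun 'I_n -> 'I_3} * {ffun 'I_n -> bool})
      ((\prod_k pauli_weight p1 p2 p3 (t.1 k)) * \prod_k flip_weight (p1 + p2 + p3) (t.2 k))%:C%C *
      (pauli_string t.1 t.2 b a * (pauli_string t.1 t.2 b' a')^*).
Proof.
move=> h1 h2 h3 hV b a b' a'.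
pose f (k : 'I_n) (i : 'I_3) (s : bool) := (flip_weight (p1 + p2 + p3) s)%:C%C *
      (pauli_pow R i s (b k) (a k) * (pauli_pow R i s (b' k) (a' k))^*).
transitivity (\prod_k \sum_e V (b k, e) (a k) * (V (b' k, e) (a' k))^*).
  rewrite -(sum_ffun_prod (fun k e => V (b k, e) (a k) * (V (b' k, e) (a' k))^*)).
  by apply: eq_bigr => e _; rewrite mul1r /kraus /isom_pow rmorph_prod -big_split.
under eq_bigr => k _ do rewrite (pauli_kraus h1 h2 h3 hV).
rewrite -(sum_ffun_prod (fun k (i : 'I_3) => (pauli_weight p1 p2 p3 i)%:C%C * \sum_(s : bool) f k i s)).
rewrite -(pair_bigA _ (fun i s => ((\prod_k pauli_weight p1 p2 p3 (i k)) * \prod_k flip_weight (p1 + p2 + p3) (s k))%:C%C *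
      (pauli_string i s b a * (pauli_string i s b' a')^*))) /=.
apply: eq_bigr => i _; rewrite big_split /= -(sum_ffun_prod (fun k => f k (i k))) mulr_sumr.
apply: eq_bigr => s _; rewrite rmorphM /= !rmorph_prod /= -mulrA; congr (_ * _).
by rewrite /pauli_string -!big_split.
Qed.

(** The error is taken to be [d ^+ 2] because [key_code_fidelity] loses a square root. *)
Lemma good_key_code_classical_test (p1 p2 p3 : R) (E : finType)
    (V : op R ('I_2 * E)%type 'I_2) (K : nat) (d : R) :
  0 <= p1 -> 0 <= p2 -> 0 <= p3 -> 
  isometric_extension (@pauli_channel R p1 p2 p3) V ->
  0 < d <= 1 -> good_key_code V n K (d ^+ 2) -> (0 < K)%N /\
  exists T : {ffun 'I_n -> bool} -> R,
  [/\ forall s, 0 <= T s <= 1,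
      \sum_s 2%:R^-1 ^+ n * T s <= K%:R^-1 &
      (1 - d) ^+ 2 <= \sum_(s : {ffun 'I_n -> bool}) (\prod_k flip_weight (p1 + p2 + p3) (s k)) * T s].
Proof.
move=> h1 h2 h3 hV /andP[d0 d1] [rho [M [hrho [[Mp M1] he]]]].
(* Without outcomes the measurement operators would sum to 0, not to the identity; one diagonal
   entry shows it. *)
have K0 : (0 < K)%N.
  rewrite lt0n; apply/eqP => K0; move: M1 => /(_ [ffun=> ord0] [ffun=> ord0]).
  rewrite /idop eqxx big1 => [/eqP|[x hx] _]; first by rewrite eq_sym oner_eq0.
  by exfalso; move: hx; rewrite K0.
split=> //.
have gG x : exists G : op R Qn Qn, rho x = opmul G (adj G) by apply: psd_factor; case: (hrho x).
have gL x : exists L : op R Qn Qn, M x = opmul L (adj L) by apply: psd_factor.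
pose G x := projT1 (cid (gG x)); have hG x : rho x = opmul (G x) (adj (G x)) := projT2 (cid (gG x)).
pose L x := adj (projT1 (cid (gL x))).
have hL x : M x = opmul (adj (L x)) (L x) by rewrite /L adjK; exact: projT2 (cid (gL x)).
have Gn x : hs (G x) = 1 by rewrite hs_trace traceC -hG; case: (hrho x).
have Ln b b' : \sum_x opmul (adj (L x)) (L x) b b' = @idop R _ b b'.
  by rewrite -M1; apply: eq_bigr => x _; rewrite hL.
have d2 : 0 < d ^+ 2 by rewrite exprn_gt0.
have [W [Wc fid]] := key_code_fidelity (proj1 hV) hG hL K0 Gn d2 he.
pose tc i s := sqn (privacy_test G L W (pauli_string i s)).
have tcR i s : tc i s = (complex.Re (tc i s))%:C%C.
  by rewrite RRe_real // ger0_real // sqn_ge0.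
have t0 i s : 0 <= complex.Re (tc i s) by rewrite -ler0c -tcR sqn_ge0.
have t1 i s : complex.Re (tc i s) <= 1.
  rewrite -lecR -tcR; apply: privacy_test_le1 => //; exact: pauli_string_unitary.
have w0 i : 0 <= \prod_k pauli_weight p1 p2 p3 (i k).
  by apply: prodr_ge0 => k _; apply: pauli_weight_ge0.
have w1 : \sum_(i : {ffun 'I_n -> 'I_3}) \prod_(k < n) pauli_weight p1 p2 p3 (i k) = 1.
  rewrite -(bigA_distr_bigA (fun (k : 'I_n) j => pauli_weight p1 p2 p3 j)) big1 // => k _.
  exact: sum_pauli_weight.
(* The squared norm of the test on P(i,s), averaged over the axes [i]. *)
exists (fun s => \sum_(i : {ffun 'I_n -> 'I_3}) (\prod_k pauli_weight p1 p2 p3 (i k)) * complex.Re (tc i s)); split.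
- move=> s; apply/andP; split; first by apply: sumr_ge0 => i _; rewrite mulr_ge0.
  by rewrite -[X in _ <= X]w1; apply: ler_sum => i _; rewrite ler_piMr.
- under eq_bigr => s _ do rewrite mulr_sumr.
  rewrite exchange_big /= -[X in _ <= X]mul1r -[X in _ <= X * _]w1 mulr_suml; apply: ler_sum => i _.
  under eq_bigr => s _ do rewrite mulrCA.
  rewrite -mulr_sumr ler_wpM2l // -lecR rmorph_sum /=.
  under eq_bigr => s _ do rewrite rmorphM rmorphXn /= fmorphV rmorph_nat -tcR.
  rewrite fmorphV rmorph_nat.
  (* For each fixed [i], uniform bits have the Choi matrix of the rank-one eigenprojections, to
     which [privacy_test_rank1] applies. *)
  rewrite (sum_sqn_privacy_test _ _ _ (fun=> 2%:R^-1 ^+ n) (pauli_string i)).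
  have := privacy_test_rank1 K0 Gn Ln Wc (sqn_eigvec_string i) (eigvec_string_complete i).
  under eq_bigr => c _ do rewrite -[sqn _]mul1r.
  rewrite (sum_sqn_privacy_test _ _ _ (fun=> 1) (fun c b a => eigvec_string i c b * (eigvec_string i c a)^*)).
  congr (_ <= _); apply: eq_bigr => f _; apply: eq_bigr => s _; apply: eq_bigr => s' _.
  by rewrite pauli_string_dephasing.
- move: fid; have -> : sqrtC (d ^+ 2)%:C%C = d%:C%C :> C.
    by rewrite rmorphXn /= exprnP sqrCK // ler0c ltW.
  have -> : \sum_e sqn (privacy_test G L W (kraus V e)) =
    (\sum_(s : {ffun 'I_n -> bool}) (\prod_k flip_weight (p1 + p2 + p3) (s k)) *
      (\sum_(i : {ffun 'I_n -> 'I_3}) (\prod_k pauli_weight p1 p2 p3 (i k)) * complex.Re (tc i s)))%:C%C.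
    under eq_bigr => e _ do rewrite -[sqn _]mul1r.
    rewrite (sum_sqn_privacy_test _ _ _ (fun=> 1) (fun e : nfold n E => kraus V e)).
    under eq_bigr => f _ do under eq_bigr => s _ do under eq_bigr => s' _ do
      rewrite (kraus_pauli_string h1 h2 h3 hV).
    rewrite -(sum_sqn_privacy_test G L W
      (fun t : {ffun 'I_n -> 'I_3} * {ffun 'I_n -> bool} =>
         ((\prod_k pauli_weight p1 p2 p3 (t.1 k)) * \prod_k flip_weight (p1 + p2 + p3) (t.2 k))%:C%C)
      (fun t => pauli_string t.1 t.2)).
    rewrite -(pair_bigA _ (fun i s => ((\prod_k pauli_weight p1 p2 p3 (i k)) * \prod_k flip_weight (p1 + p2 + p3) (s k))%:C%C * tc i s)) /=.
    rewrite exchange_big rmorph_sum /=; apply: eq_bigr => s _.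
    rewrite mulr_sumr rmorph_sum /=; apply: eq_bigr => i _.
    by rewrite tcR /= -rmorphM mulrA /=; congr ((_ * _)%:C)%C; rewrite mulrC.
  set al := (X in sqrtC X%:C%C) => fid.
  have fid' : (1 - d%:C%C) ^+ 2 <= al%:C%C :> C.
    rewrite -[X in _ <= X]sqrtCK ler_sqr ?nnegrE //; last first.
      by apply: le_trans fid; rewrite subr_ge0 lecR.
    by rewrite subr_ge0 lecR.
  by move: fid'; rewrite -lecR rmorphXn rmorphB rmorph1.
Qed.

End NFold.

(** * Classical hypothesis testing *)

Section Classical.
Variable R : realType.

(** Convexity: the values of exp at [x] and 0 lie above its tangent at [z], and mixing the two
    tangent bounds with weights [t] and [1 - t] gives [expR z]. *)
Lemma expR_chord (t x : R) : 0 <= t <= 1 -> expR (t * x) <= 1 + t * (expR x - 1).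
Proof.
move=> /andP[t0 t1]; set z := t * x.
have e0 := expR_gt0 z.
have h1 : expR z * (1 + (x - z)) <= expR x.
  have := expR_ge1Dx (x - z); rewrite expRD expRN -(ler_pM2l e0).
  by rewrite mulrCA mulfV ?mulr1 // gt_eqF.
have h2 : expR z * (1 - z) <= 1.
  have := expR_ge1Dx (- z); rewrite expRN -(ler_pM2l e0).
  by rewrite mulfV // gt_eqF.
have := lerD (ler_wpM2l t0 h1) (ler_wpM2l (_ : 0 <= 1 - t) h2).
rewrite subr_ge0 => /(_ t1).
have -> : t * (expR z * (1 + (x - z))) + (1 - t) * (expR z * (1 - z)) = expR z.
  by rewrite /z; ring.
by move=> h; apply: le_trans h _; rewrite le_eqVlt; apply/orP; left; apply/eqP; ring.
Qed.

Lemma ln_prod (I : finType) (f : I -> R) : (forall i, 0 < f i) ->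
  ln (\prod_i f i) = \sum_i ln (f i).
Proof.
move=> f0; suff [] : 0 < \prod_i f i /\ ln (\prod_i f i) = \sum_i ln (f i) by [].
apply: (big_ind2 (fun x y => 0 < x /\ ln x = y)) => //.
- by rewrite ln1 ltr01.
- by move=> x1 x2 y1 y2 [hx <-] [hy <-]; rewrite mulr_gt0 // lnM ?posrE.
Qed.

(** The relative entropy, in nats, of Bernoulli(q) to a fair bit. The cases q = 0 and q = 1 are
    separate, as there 0 log 0 counts as 0. *)
Lemma flip_weight_entropy (q : R) : 0 <= q <= 1 ->
  \sum_b flip_weight q b * ln (2 * flip_weight q b) = ln 2 * (1 - binH q).
Proof.
move=> /andP[q0 q1]; rewrite big_bool /= /binH /log2.
have l2 : ln 2 != 0 :> R by rewrite gt_eqF // ln_gt0 // ltr1n.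
have [->|qn0] := eqVneq q 0.
  by rewrite eq_sym oner_eq0 !subr0 ln1 !mul0r !mulr0 !mulr1; field.
have [->|qn1] := eqVneq q 1.
  by rewrite !subrr ln1 !mul0r !mulr0 !mulr1; field.
have qp : 0 < q by rewrite lt_def qn0.
have qp' : 0 < 1 - q by rewrite subr_gt0 lt_def eq_sym qn1.
by rewrite !lnM ?posrE //; field.
Qed.

Lemma sum_flip_weight (q : R) : \sum_b flip_weight q b = 1.
Proof. by rewrite big_bool /=; ring. Qed.

Lemma flip_weight_ge0 (q : R) b : 0 <= q <= 1 -> 0 <= flip_weight q b.
Proof. by move=> /andP[q0 q1]; case: b; rewrite /flip_weight ?subr_ge0. Qed.

Section Bits.
Variable n : nat.
Implicit Types s : {ffun 'I_n -> bool}.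

Lemma expectation_bit (w : bool -> R) (g : bool -> R) (k : 'I_n) : \sum_b w b = 1 ->
  \sum_(s : {ffun 'I_n -> bool}) (\prod_j w (s j)) * g (s k) = \sum_b w b * g b.
Proof.
move=> w1.
transitivity (\prod_(j < n) \sum_b w b * (if j == k then g b else 1)).
  rewrite bigA_distr_bigA; apply: eq_bigr => s _; rewrite big_split /=; congr (_ * _).
  rewrite (bigD1 k) //= eqxx big1 ?mulr1 // => j jk.
  by rewrite (negbTE jk).
rewrite (bigD1 k) //= eqxx [X in _ * X]big1 ?mulr1 // => j jk.
by rewrite (negbTE jk); under eq_bigr => b _ do rewrite mulr1.
Qed.

Lemma relative_entropy_bits (q : R) : 0 <= q <= 1 ->
  \sum_(s : {ffun 'I_n -> bool}) (\prod_k flip_weight q (s k)) *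
     ln (\prod_k (2 * flip_weight q (s k))) = n%:R * (ln 2 * (1 - binH q)).
Proof.
move=> q01; pose w := flip_weight q.
transitivity (\sum_(s : {ffun 'I_n -> bool}) \sum_k (\prod_j w (s j)) * ln (2 * w (s k))).
  apply: eq_bigr => s _; rewrite -mulr_sumr.
  (* A string of probability 0 contributes nothing to either side; otherwise all factors are
     positive and the logarithm splits. *)
  have [/existsP[k /eqP wk]|] := boolP [exists k, w (s k) == 0].
    by rewrite (bigD1 k) //= -/w wk !mul0r.
  rewrite negb_exists => /forallP wn; congr (_ * _); apply: ln_prod => k.
  by rewrite mulr_gt0 // lt_def wn flip_weight_ge0.
rewrite exchange_big /=; under eq_bigr => k _ do
  rewrite (expectation_bit (fun b => ln (2 * w b)) k (sum_flip_weight q)) flip_weight_entropy //.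
by rewrite sumr_const card_ord mulr_natl.
Qed.

Lemma sum_prod_flip_weight (q : R) :
  \sum_(s : {ffun 'I_n -> bool}) \prod_k flip_weight q (s k) = 1.
Proof.
by rewrite -(bigA_distr_bigA (fun (k : 'I_n) b => flip_weight q b)) big1 // => k _; rewrite sum_flip_weight.
Qed.

(* Gibbs' variational bound E_P[f] <= D(P || U) + ln E_U[exp f] for f = T ln K, where U
is uniform and E_U[K^T] <= 2. *)
Lemma hypothesis_test_converse (q : R) (K : nat) (T : {ffun 'I_n -> bool} -> R) :
  0 <= q <= 1 -> (0 < K)%N -> (forall s, 0 <= T s <= 1) ->
  \sum_s 2%:R^-1 ^+ n * T s <= K%:R^-1 ->
  (\sum_(s : {ffun 'I_n -> bool}) (\prod_k flip_weight q (s k)) * T s) * ln K%:R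
    <= n%:R * (ln 2 * (1 - binH q)) + ln 2.
Proof.
move=> q01 K0 T01 TU; rewrite -relative_entropy_bits //.
have Kp : 0 < K%:R :> R by rewrite ltr0n.
pose P s := \prod_k flip_weight q (s k).
pose u : R := 2%:R^-1 ^+ n.
have u0 : 0 < u by rewrite exprn_gt0 // invr_gt0 ltr0n.
have P2 s : \prod_k (2 * flip_weight q (s k)) = P s / u.
  by rewrite big_split /= prodr_const card_ord /u exprVn invrK mulrC.
have Pge s : 0 <= P s by apply: prodr_ge0 => k _; apply: flip_weight_ge0.
(* The pointwise bound is [1 + z <= expR z] multiplied by [P s]. The [ln 2] compensates E_U[K^T] <=
   2, so the right-hand sides sum to at most 0. *)
have main s : P s * (T s * ln K%:R) - P s * ln (P s / u) - P s * ln 2 <=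
    2^-1 * (u * (1 + T s * (K%:R - 1))) - P s.
  have ex : expR (T s * ln K%:R) <= 1 + T s * (K%:R - 1).
    by have := expR_chord (ln K%:R) (T01 s); rewrite lnK // posrE.
  have [P0|Pn] := eqVneq (P s) 0.
    rewrite P0 !mul0r !subr0; apply: mulr_ge0; first by rewrite invr_ge0 ler0n.
    by apply: mulr_ge0; [exact: ltW | exact: (le_trans (expR_ge0 _) ex)].
  have Pp : 0 < P s by rewrite lt_def Pn Pge.
  apply: (@le_trans _ _ (2^-1 * (u * expR (T s * ln K%:R)) - P s)); last first.
    by rewrite lerD2r ler_wpM2l // ler_wpM2l // ltW.
  set y := (T s * ln K%:R); pose z := y - ln (P s / u) - ln 2.
  have zE : expR z = expR y * u / P s / 2.
    rewrite /z !expRD !expRN !lnK ?posrE ?divr_gt0 // invf_div.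
    by rewrite mulrA.
  have := expR_ge1Dx z; rewrite zE -(ler_pM2l Pp) /z => h.
  rewrite -subr_ge0; move: h; rewrite -subr_ge0; congr (0 <= _).
  by field.
have : \sum_s (P s * (T s * ln K%:R) - P s * ln (P s / u) - P s * ln 2) <=
    \sum_s (2^-1 * (u * (1 + T s * (K%:R - 1))) - P s).
  by apply: ler_sum => s _; apply: main.
rewrite !sumrB -mulr_sumr -mulr_suml sum_prod_flip_weight mul1r.
have -> : \sum_s u * (1 + T s * (K%:R - 1)) = 1 + (K%:R - 1) * \sum_s u * T s.
  under eq_bigr => s _ do rewrite mulrDr mulr1 mulrA.
  rewrite big_split /= -mulr_suml [X in _ + X = _]mulrC; congr (_ + _).
  by rewrite sumr_const card_ffun card_bool card_ord -[LHS]mulr_natl natrX /u -exprMn mulfV ?expr1n // pnatr_eq0.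
have K1 : 0 <= K%:R - 1 :> R by rewrite subr_ge0 ler1n.
have := ler_wpM2l K1 TU; rewrite -/u => h.
have h' : (K%:R - 1) / K%:R <= 1 :> R by rewrite ler_pdivrMr // mul1r gerBl.
have -> : \sum_s P s * (T s * ln K%:R) = (\sum_s P s * T s) * ln K%:R.
  by rewrite mulr_suml; apply: eq_bigr => s _; rewrite mulrA.
have -> : \sum_s P s * ln (P s / u) = \sum_s P s * ln (\prod_k (2 * flip_weight q (s k))).
  by apply: eq_bigr => s _; rewrite P2.
rewrite -/(P _) => hm; lra.
Qed.

End Bits.

(** * Limits in the block length and in the error *)

Lemma limn_einf_le_lim (u v : (\bar R)^nat) (l : \bar R) (N : nat) :
  (forall n, (N <= n)%N -> (u n <= v n)%E) -> (v @ \oo --> l)%classic ->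
  (limn_einf u <= l)%E.
Proof.
move=> uv vl; rewrite limn_einf_lim -(cvg_lim _ vl) //.
apply: lee_lim.
- exact: is_cvg_einfs.
- by apply/cvg_ex; exists l.
near=> n; apply: (@le_trans _ _ (u n)).
  by apply: ereal_inf_lbound; exists n => /=.
by apply: uv; near: n; exists N.
Unshelve. all: by end_near.
Qed.

Lemma cvg_offset_harmonic (c a : R) :
  ((fun n => ((c + 2 * harmonic n) / a)%:E) @ \oo --> (c / a)%:E)%classic.
Proof.
apply: cvg_EFin; first by near=> n.

have h : ((fun n => (c + 2 * harmonic n) / a) @ \oo --> (c + 2 * 0) / a)%classic.
  apply: cvgMl; apply: cvgD; first exact: cvg_cst.
  by apply: cvgMr; apply: cvg_harmonic.
by rewrite mulr0 addr0 in h.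
Unshelve. all: by end_near.
Qed.

Lemma le_of_forall_scaled (r c : R) :
  (forall d, 0 < d < 1 -> r * (1 - d) ^+ 2 <= c) -> r <= c.
Proof.
move=> h; rewrite leNgt; apply/negP => cr.
(* The value 1/2 of [d] gives r/4 <= c < r, hence r > 0. *)
have h2 := h (2^-1) _; have {}h2 : r * (1 - 2^-1) ^+ 2 <= c by apply: h2; lra.
have r0 : 0 < r by lra.
(* Chosen so that r (1 - d)^2 >= r - 2 r d >= (r + c)/2 > c. *)
pose d := Num.min (2^-1) ((r - c) / (4 * r)).
have d0 : 0 < d by rewrite lt_min; apply/andP; split; [lra | rewrite divr_gt0 ?mulr_gt0 // subr_gt0].
have d1 : d <= 2^-1 by rewrite ge_min lexx.
have dr : d * (4 * r) <= r - c.
  by rewrite -ler_pdivlMr ?mulr_gt0 // ge_min lexx orbT.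
have := h d _; have d01 : 0 < d < 1 by lra.
move=> /(_ d01); nra.
Qed.

End Classical.

(** * The capacity bound, from finite block length to rates *)

Unset Implicit Arguments.

Theorem theorem12 (R : realType) (p1 p2 p3 : R) (E : finType)
  (V : op R ('I_2 * E)%type 'I_2) :
  0 <= p1 -> 0 <= p2 -> 0 <= p3 -> p1 + p2 + p3 <= 1 ->
  isometric_extension (@pauli_channel R p1 p2 p3) V ->
  (private_capacity V <= (1 - binH (p1 + p2 + p3))%:E)%E.
Proof.
move=> h1 h2 h3 hp hV; set c := 1 - binH _.
have q01 : 0 <= p1 + p2 + p3 <= 1 by rewrite hp !addr_ge0.
apply: ge_ereal_sup => _ [r hr <-]; rewrite lee_fin.
(* Codes of error [d ^+ 2] give r (1 - d)^2 <= c for every fixed [d] between 0 and 1. *)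
apply: le_of_forall_scaled => d /andP[d0 d1].
have a0 : 0 < (1 - d) ^+ 2 by rewrite exprn_gt0 // subr_gt0.
have d2 : 0 < d ^+ 2 by rewrite exprn_gt0.
have [N0 [Kn [good lim]]] := hr _ d2.
rewrite -ler_pdivlMr // -lee_fin; apply: (le_trans lim).
have vl := @cvg_offset_harmonic R c ((1 - d) ^+ 2).
(* Starting at 1 or later makes the division by [n] meaningful. *)
apply: (@limn_einf_le_lim _ _ _ _ (maxn N0 1) _ vl) => n.
rewrite geq_max => /andP[nN n1]; rewrite lee_fin.
have dle : 0 < d <= 1 by rewrite d0 ltW.
have [K0 [T [T01 TU Tal]]] := good_key_code_classical_test h1 h2 h3 hV dle (good n nN).
have H := hypothesis_test_converse q01 K0 T01 TU.
have lnK0 : 0 <= ln (Kn n)%:R :> R by rewrite ln_ge0 // ler1n.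
have {}H := le_trans (ler_wpM2r lnK0 Tal) H.
have l2 : 0 < ln 2 :> R by rewrite ln_gt0 // ltr1n.
have np : 0 < n%:R :> R by rewrite ltr0n.
rewrite /log2 ler_pdivrMr // ler_pdivrMr // -mulrA [X in _ <= X]mulrAC.
rewrite ler_pdivlMr // mulrC.
apply: (le_trans H); rewrite -/c /harmonic.
(* As [harmonic n] is 1/(n+1), the additive [ln 2] is absorbed because 2n/(n+1) >= 1 for n >= 1. *)
have -> : (c + 2 * n.+1%:R^-1) * (n%:R * ln 2) =
    n%:R * (ln 2 * c) + ln 2 * (2 * n%:R / n.+1%:R) by field.
rewrite lerD2l; apply: ler_peMr; first exact: ltW.
rewrite ler_pdivlMr ?ltr0n // mul1r.
by rewrite -natrM ler_nat mul2n -addnn -addn1 leq_add2l.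
Qed.
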